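(* There is an algorithm that, given a set $S$ of $n$ points in the plane, where $n$ is even (and positive), runs in $O(n^2)$ time and returns a star cover $\alpha$ of $S$ such that either: 1. $\Delta_\alpha=4$, and this is the minimum possible value of $\Delta_{\alpha'}$ over all star covers $\alpha'$ of $S$ (i.e. $\alpha$ is optimal); or 2. $\Delta_\alpha\le 2$.
   Context: A (polygonal) curve is given by its finite non-empty sequence of vertices. Two curves $P,Q$ partition a finite point set $S$ if there is a partition of $S$ into two sets $A,B$ such that the vertex set of $P$ is exactly $A$, the vertex set of $Q$ is exactly $B$, and each point of $S$ is used exactly once (either in $P$ or in $Q$). A paired-walk along $P$ and $Q$ is a sequence of pairs $\{(P_i,Q_i)\}_{i=1}^k$ such that $P_1,\dots,P_k$ and $Q_1,\dots,Q_k$ partition the vertex sequences of $P$ and $Q$, respectively, in order, into disjoint non-empty contiguous subsequences, and for every $i$ either $|P_i|=1$ or $|Q_i|=1$. Its cost is $\max_i\max_{(p,q)\in P_i\times Q_i}\|p-q\|$. The discrete Fréchet distance $d_{dF}(P,Q)$ is the minimum cost of a paired-walk. $\varepsilon^*$ is the minimum of $d_{dF}(P,Q)$ over all pairs of curves $P,Q$ that partition $S$. $G_{\varepsilon^*}$ is the graph with vertex set $S$ in which distinct $u,v$ are adjacent iff $\|u-v\|\le\varepsilon^*$. A star subgraph $H$ of $G_{\varepsilon^*}$ consists of a center together with at least one leaf, each leaf being adjacent to the center in $G_{\varepsilon^*}$; its balance is $\mathbf{b}(H)=\deg(H)-1$, where $\deg(H)$ is the degree of the center in $H$. For a set $X$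 of stars, $\mathbf{b}(X)=\sum_{H\in X}\mathbf{b}(H)$. A star cover of $S$ is a set $\alpha=\{H_1,\dots,H_t\}$ of pairwise (vertex-)disjoint stars in $G_{\varepsilon^*}$ that together cover $S$. For a partition of $\alpha$ into two sets of stars $\rho,\beta$, let $\Delta_\alpha(\rho,\beta)=|\mathbf{b}(\rho)-\mathbf{b}(\beta)|$, and let $\Delta_\alpha$ be the minimum of $\Delta_\alpha(\rho,\beta)$ over all partitions $\rho,\beta$ of $\alpha$. *)

(* Defs.v *)
(* MathComp world: points have coordinates in an arbitrary [R : realType]. *)
From HB Require Import structures.
From mathcomp Require Import all_boot all_order all_algebra finmap.
From mathcomp Require Import all_classical reals.

Set Implicit Arguments.
Unset Strict Implicit.
Unset Printing Implicit Defensive.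

Import Order.TTheory GRing.Theory Num.Theory.
Local Open Scope ring_scope.

(* The norm that MathComp-Analysis puts on products and row vectors is the
   sup norm, hence the explicit Euclidean distance below. *)
Notation plane R := (R * R)%type.

Definition dist (R : realType) (p q : plane R) : R :=
  Num.sqrt ((p.1 - q.1) ^+ 2 + (p.2 - q.2) ^+ 2).

Section Curves.
Variable R : realType.
Implicit Types (P Q : seq (plane R)) (S : {fset plane R}).

Definition partition_into_curves S P Q : Prop :=
  [/\ P != [::], Q != [::] &
    exists A B : {fset plane R},
      [/\ (A `|` B)%fset = S, (A `&` B)%fset = fset0,
          P =i A, Q =i B & uniq P /\ uniq Q]].

(* The i-th element of a walk is the pair (P_i, Q_i). *)
Notation walk := (seq (seq (plane R) * seq (plane R))).

Definition paired_walk P Q (w : walk) : Prop :=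
  [/\ flatten [seq b.1 | b <- w] = P,
      flatten [seq b.2 | b <- w] = Q,
      forall b, b \in w -> b.1 != [::] /\ b.2 != [::] &
      forall b, b \in w -> size b.1 = 1%N \/ size b.2 = 1%N].

Definition walk_cost (w : walk) : R :=
  \big[Num.max/0]_(b <- w) \big[Num.max/0]_(p <- b.1)
    \big[Num.max/0]_(q <- b.2) dist p q.

Definition walk_costs P Q : set R :=
  [set walk_cost w | w in [set w | paired_walk P Q w]]%classic.

(* This infimum and the next one are minima: see [dFrechet_min] and
   [eps_star_min]. *)
Definition dFrechet P Q : R := inf (walk_costs P Q).

Definition curve_dists S : set R :=
  [set d | exists P Q, partition_into_curves S P Q /\ d = dFrechet P Q]%classic.

Definition eps_star S : R := inf (curve_dists S).

End Curves.

(* A star is the pair of its center and its set of leaves. A one-edge star has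
   two such encodings; they share vertices, so no star cover contains both. *)
Notation star R := (plane R * {fset plane R})%type.

Section Stars.
Variable R : realType.
Implicit Types (S : {fset plane R}).

Definition adj (eps : R) (u v : plane R) : bool := (u != v) && (dist u v <= eps).

Implicit Types (H : star R) (alpha rho beta : {fset star R}).

Definition star_vertices H : {fset plane R} := (H.1 |` H.2)%fset.

Definition is_star S (eps : R) H : Prop :=
  [/\ (star_vertices H `<=` S)%fset, H.2 != fset0 &
      forall v, v \in H.2 -> adj eps H.1 v].

Definition star_balance H : int := (#|` H.2|)%:Z - 1.

Definition balance (X : {fset star R}) : int := \sum_(H <- X) star_balance H.

Definition star_cover S alpha : Prop :=
  [/\ forall H, H \in alpha -> is_star S (eps_star S) H,
      forall H H', H \in alpha -> H' \in alpha -> H != H' ->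
        (star_vertices H `&` star_vertices H')%fset = fset0 &
      forall p, p \in S -> exists2 H, H \in alpha & p \in star_vertices H].

Definition Delta2 rho beta : nat := `|balance rho - balance beta|%N.

(* Either part of a partition may be empty. The default value of the iterated
   minimum is the value at the partition (alpha, fset0). *)
Definition Delta alpha : nat :=
  \big[minn/Delta2 alpha fset0]_(rho <- fpowerset alpha)
    Delta2 rho (alpha `\` rho)%fset.

End Stars.

(* A real RAM with unit costs, programmed by structured commands. The memory
   consists of arrays, named by naturals, of natural numbers and of real
   numbers; a program, being finite, uses finitely many array names, and the
   scalar variables are the cells 0. There is no rounding operation, no
   conversion between the two kinds of numbers, no multiplication of naturals,
   and the only real constants are the integers. Division by 0 returns 0. *)
Inductive nexp : Type :=
  | NConst of nat
  | NGet of nat & nexp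
  | NAdd of nexp & nexp
  | NSub of nexp & nexp.

Inductive rexp : Type :=
  | RConst of int
  | RGet of nat & nexp
  | RAdd of rexp & rexp
  | RSub of rexp & rexp
  | RMul of rexp & rexp
  | RDiv of rexp & rexp.

Inductive bexp : Type :=
  | BNatLe of nexp & nexp
  | BRealLe of rexp & rexp
  | BNot of bexp
  | BAnd of bexp & bexp.

Inductive cmd : Type :=
  | Skip
  | NSet of nat & nexp & nexp
  | RSet of nat & nexp & rexp
  | Seq of cmd & cmd
  | If of bexp & cmd & cmd
  | While of bexp & cmd.

(* All operands are evaluated, so the cost of an expression is its size. *)
Fixpoint ncost (e : nexp) : nat :=
  match e with
  | NConst _ => 1
  | NGet _ i => (ncost i).+1
  | NAdd e1 e2 | NSub e1 e2 => (ncost e1 + ncost e2).+1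
  end.

Fixpoint rcost (e : rexp) : nat :=
  match e with
  | RConst _ => 1
  | RGet _ i => (ncost i).+1
  | RAdd e1 e2 | RSub e1 e2 | RMul e1 e2 | RDiv e1 e2 =>
      (rcost e1 + rcost e2).+1
  end.

Fixpoint bcost (e : bexp) : nat :=
  match e with
  | BNatLe e1 e2 => (ncost e1 + ncost e2).+1
  | BRealLe e1 e2 => (rcost e1 + rcost e2).+1
  | BNot e1 => (bcost e1).+1
  | BAnd e1 e2 => (bcost e1 + bcost e2).+1
  end.

Section Semantics.
Variable R : realType.

Record state : Type := State {
  nmem : nat -> nat -> nat;
  rmem : nat -> nat -> R
}.

Definition upd (T : Type) (m : nat -> nat -> T) (a i : nat) (v : T) :
    nat -> nat -> T :=
  fun b j => if (b == a) && (j == i) then v else m b j.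

Definition nupd (s : state) a i v := State (upd (nmem s) a i v) (rmem s).
Definition rupd (s : state) a i v := State (nmem s) (upd (rmem s) a i v).

Fixpoint neval (s : state) (e : nexp) : nat :=
  match e with
  | NConst k => k
  | NGet a i => nmem s a (neval s i)
  | NAdd e1 e2 => neval s e1 + neval s e2
  | NSub e1 e2 => neval s e1 - neval s e2
  end%N.

Fixpoint reval (s : state) (e : rexp) : R :=
  match e with
  | RConst z => z%:~R
  | RGet a i => rmem s a (neval s i)
  | RAdd e1 e2 => reval s e1 + reval s e2
  | RSub e1 e2 => reval s e1 - reval s e2
  | RMul e1 e2 => reval s e1 * reval s e2
  | RDiv e1 e2 => reval s e1 / reval s e2
  end.

Fixpoint beval (s : state) (e : bexp) : bool :=
  match e with
  | BNatLe e1 e2 => (neval s e1 <= neval s e2)%N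
  | BRealLe e1 e2 => reval s e1 <= reval s e2
  | BNot e1 => ~~ beval s e1
  | BAnd e1 e2 => beval s e1 && beval s e2
  end.

(* [exec c s t s']: started in [s], the command [c] halts in [s'] after [t]
   unit-cost operations. *)
Inductive exec : cmd -> state -> nat -> state -> Prop :=
  | ExecSkip s : exec Skip s 1 s
  | ExecNSet a i e s :
      exec (NSet a i e) s (ncost i + ncost e).+1
        (nupd s a (neval s i) (neval s e))
  | ExecRSet a i e s :
      exec (RSet a i e) s (ncost i + rcost e).+1
        (rupd s a (neval s i) (reval s e))
  | ExecSeq c1 c2 s s1 s2 t1 t2 :
      exec c1 s t1 s1 -> exec c2 s1 t2 s2 ->
      exec (Seq c1 c2) s (t1 + t2) s2
  | ExecIfTrue b c1 c2 s s' t :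
      beval s b -> exec c1 s t s' ->
      exec (If b c1 c2) s (bcost b + t).+1 s'
  | ExecIfFalse b c1 c2 s s' t :
      ~~ beval s b -> exec c2 s t s' ->
      exec (If b c1 c2) s (bcost b + t).+1 s'
  | ExecWhileTrue b c s s1 s2 t1 t2 :
      beval s b -> exec c s t1 s1 -> exec (While b c) s1 t2 s2 ->
      exec (While b c) s (bcost b + t1 + t2).+1 s2
  | ExecWhileFalse b c s :
      ~~ beval s b -> exec (While b c) s (bcost b).+1 s.

(* The number of points is in cell 0 of natural array 0, the abscissas and the
   ordinates are in real arrays 0 and 1, and every other cell holds 0. *)
Definition input_state (pts : seq (plane R)) : state :=
  State
    (fun a i => if (a == 0%N) && (i == 0%N) then size pts else 0%N)
    (fun a i => match a with
                | 0%N => (nth 0 pts i).1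
                | 1%N => (nth 0 pts i).2
                | _ => 0
                end).

(* [c i] is the index of the center of the star that contains the i-th point;
   the centers are the fixed points of [c]. *)
Definition stars_of (pts : seq (plane R)) (c : nat -> nat) :
    {fset star R} :=
  [fset (nth 0 pts j,
         [fset nth 0 pts i | i in iota 0 (size pts) & (i != j) && (c i == j)])
  | j in iota 0 (size pts) & c j == j]%fset.

(* The output is read off natural array 1. *)
Definition output_cover (pts : seq (plane R)) (s : state) :
    {fset star R} :=
  stars_of pts (nmem s 1).

Lemma exec_det c s t1 t2 s1 s2 :
  exec c s t1 s1 -> exec c s t2 s2 -> t1 = t2 /\ s1 = s2.
Proof.
move=> H; elim: H t2 s2 => {c s t1 s1}.
- by move=> s t2 s2 H; inversion H.
- by move=> a i e s t2 s2 H; inversion H.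
- by move=> a i e s t2 s2 H; inversion H.
- move=> c1 c2 s s1 s2 t1 t2 _ IH1 _ IH2 t s' H.
  inversion H as [| | |? ? ? u ? v1 v2 E1 E2| | | |]; subst.
  by case: (IH1 _ _ E1) => *; subst; case: (IH2 _ _ E2) => *; subst.
- move=> b c1 c2 s s' t hb _ IH t2 s2 H.
  inversion H as [| | | |? ? ? ? ? ? hb' E|? ? ? ? ? ? hb' E| |]; subst.
    by case: (IH _ _ E) => *; subst.
  by rewrite hb in hb'.
- move=> b c1 c2 s s' t hb _ IH t2 s2 H.
  inversion H as [| | | |? ? ? ? ? ? hb' E|? ? ? ? ? ? hb' E| |]; subst.
    by rewrite hb' in hb.
  by case: (IH _ _ E) => *; subst.
- move=> b c s s1 s2 t1 t2 hb _ IH1 _ IH2 t s' H.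
  inversion H as [| | | | | |? ? ? u ? v1 v2 hb' E1 E2|? ? ? hb']; subst.
    by case: (IH1 _ _ E1) => *; subst; case: (IH2 _ _ E2) => *; subst.
  by rewrite hb in hb'.
- move=> b c s hb t2 s2 H.
  inversion H as [| | | | | |? ? ? ? ? ? ? hb' E1 E2|? ? ? hb']; subst => //.
  by rewrite hb' in hb.
Qed.

End Semantics.

Section Minima.
Variable R : realType.
Implicit Types (P Q : seq (plane R)) (S : {fset plane R}) (A : set R).

Lemma inf_finite_min A (l : seq R) :
  (exists x, A x) -> (forall x, A x -> x \in l) ->
  A (inf A) /\ forall x, A x -> inf A <= x.
Proof.
move=> [x0 Ax0] Al.
have [m [Am mA]] : exists m, A m /\ forall x, A x -> m <= x.
  elim: l A x0 Ax0 Al => [|a l IH] A x0 Ax0 Al; first by have := Al _ Ax0.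
  pose A' := (fun x => A x /\ x \in l) : set R.
  case: (pselect (exists x, A' x)) => [[x1 Ax1]|nA'].
    have [m [[Am ml] mA]] : exists m, A' m /\ forall x, A' x -> m <= x.
      by apply: (IH A' x1 Ax1) => x [].
    case: (pselect (A a)) => [Aa|nAa].
      have [am|ma] := leP a m.
        exists a; split=> // x Ax; have := Al _ Ax.
        rewrite inE => /orP[/eqP->//|xl].
        by apply: le_trans am _; apply: mA.
      exists m; split=> // x Ax; have := Al _ Ax.
      by rewrite inE => /orP[/eqP->|xl]; [exact: ltW | apply: mA].
    exists m; split=> // x Ax; have := Al _ Ax.
    by rewrite inE => /orP[/eqP xa|xl]; [rewrite xa in Ax | apply: mA].
  have allA x : A x -> x = a.
    move=> Ax; have := Al _ Ax; rewrite inE => /orP[/eqP//|xl].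
    by case: nA'; exists x.
  by exists x0; split=> // x Ax; rewrite (allA _ Ax) (allA _ Ax0).
have -> : inf A = m.
  apply/eqP; rewrite eq_le; apply/andP; split.
    by apply: ge_inf => //; exists m => x Ax; apply: mA.
  by apply: lb_le_inf; [exists m | move=> x Ax; apply: mA].
by split.
Qed.

Lemma bigmax_in (I : eqType) (r : seq I) (F : I -> R) (l : seq R) :
  0 \in l -> (forall i, i \in r -> F i \in l) ->
  \big[Num.max/0]_(i <- r) F i \in l.
Proof.
move=> l0 Fl; rewrite big_seq; elim/big_ind: _ => // x y xl yl.
by rewrite maxEle; case: ifP.
Qed.

Lemma walk_cost_in P Q w : paired_walk P Q w ->
  walk_cost w \in 0 :: [seq dist p q | p <- P, q <- Q].
Proof.
move=> [eP eQ _ _]; apply: bigmax_in => [|b bw]; first by rewrite inE eqxx.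
apply: bigmax_in => [|p pb]; first by rewrite inE eqxx.
apply: bigmax_in => [|q qb]; first by rewrite inE eqxx.
rewrite inE; apply/orP; right; apply: allpairs_f.
- by rewrite -eP; apply/flattenP; exists b.1 => //; apply: map_f.
- by rewrite -eQ; apply/flattenP; exists b.2 => //; apply: map_f.
Qed.

Lemma paired_walk_exists P Q : P != [::] -> Q != [::] ->
  exists w, paired_walk P Q w.
Proof.
elim: P Q => // p P IH [|q Q] // _ _.
case: P IH => [|p' P] IH.
  exists [:: ([:: p], q :: Q)]; split; rewrite /= ?cats0 //.
    by move=> b; rewrite inE => /eqP->.
  by move=> b; rewrite inE => /eqP->; left.
case: Q => [|q' Q].
  exists [:: (p :: p' :: P, [:: q])]; split; rewrite /= ?cats0 //.
    by move=> b; rewrite inE => /eqP->.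
  by move=> b; rewrite inE => /eqP->; right.
have [w [e1 e2 h1 h2]] := IH (q' :: Q) isT isT.
exists (([:: p], [:: q]) :: w); split=> /=; rewrite ?e1 ?e2 //.
  by move=> b; rewrite inE => /orP[/eqP->|/h1].
by move=> b; rewrite inE => /orP[/eqP->|/h2 //]; left.
Qed.

Lemma dFrechet_min P Q : P != [::] -> Q != [::] ->
  (exists2 w, paired_walk P Q w & walk_cost w = dFrechet P Q) /\
  (forall w, paired_walk P Q w -> dFrechet P Q <= walk_cost w).
Proof.
move=> P0 Q0; have [w0 hw0] := paired_walk_exists P0 Q0.
have [[w hw e] h] : walk_costs P Q (inf (walk_costs P Q)) /\
    forall x, walk_costs P Q x -> inf (walk_costs P Q) <= x.
  apply: (@inf_finite_min _ (0 :: [seq dist p q | p <- P, q <- Q])).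
    by exists (walk_cost w0); exists w0.
  by move=> x [w hw <-]; apply: walk_cost_in hw.
by split; [exists w | move=> v hv; apply: h; exists v].
Qed.

Lemma eps_star_min S : (1 < #|` S|)%N ->
  (exists P Q, partition_into_curves S P Q /\ dFrechet P Q = eps_star S) /\
  (forall P Q, partition_into_curves S P Q -> eps_star S <= dFrechet P Q).
Proof.
move=> S1.
have [[P [Q [h e]]] hmin] : curve_dists S (inf (curve_dists S)) /\
    forall x, curve_dists S x -> inf (curve_dists S) <= x.
  apply: (@inf_finite_min _ (0 :: [seq dist p q | p <- S, q <- S])).
    have [p pS] : exists p, p \in S.
      by apply/fset0Pn; rewrite -cardfs_gt0; apply: ltnW.
    exists (dFrechet [:: p] (enum_fset (S `\ p)%fset)).
    exists [:: p], (enum_fset (S `\ p)%fset); split=> //; split=> //.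
      rewrite -size_eq0; apply/eqP => e0.
      by move: S1; rewrite (cardfsD1 p S) pS /= e0.
    exists [fset p]%fset, (S `\ p)%fset; split=> //.
    - by rewrite fsetD1K.
    - by apply/fsetP => x; rewrite !inE; case: eqP.
    - by move=> x; rewrite !inE.
    - by split; last exact: fset_uniq.
  move=> x [P [Q [[P0 Q0 [A [B [eS _ hP hQ _]]]] ->]]].
  have [[w hw <-] _] := dFrechet_min P0 Q0.
  have := walk_cost_in hw; rewrite !inE => /orP[->//|].
  move=> /allpairsP[[p q] [/= pP qQ ->]]; apply/orP; right.
  by apply: allpairs_f; rewrite -eS inE -?hP -?hQ ?pP ?qQ ?orbT.
split; first by exists P, Q.
by move=> P' Q' h'; apply: hmin; exists P', Q'.
Qed.

Lemma Delta_min (alpha : {fset star R}) :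
  (exists rho beta, [/\ (rho `|` beta)%fset = alpha,
     (rho `&` beta)%fset = fset0 & Delta2 rho beta = Delta alpha]) /\
  (forall rho beta, (rho `|` beta)%fset = alpha ->
     (rho `&` beta)%fset = fset0 -> (Delta alpha <= Delta2 rho beta)%N).
Proof.
split.
  have : exists2 rho, (rho `<=` alpha)%fset &
      Delta2 rho (alpha `\` rho)%fset = Delta alpha.
    rewrite /Delta big_seq; elim/big_ind: _ => [|x y hx hy|rho].
    - by exists alpha => //; rewrite fsetDv.
    - by rewrite /minn; case: ifP.
    - by rewrite fpowersetE => h; exists rho.
  move=> [rho h e]; exists rho, (alpha `\` rho)%fset; split=> //.
    apply/fsetP => x; rewrite !inE.
    by case: (boolP (x \in rho)) => // /(fsubsetP h).
  by apply/fsetP => x; rewrite !inE; case: (x \in rho).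
move=> rho beta eU eI.
have -> : beta = (alpha `\` rho)%fset.
  apply/fsetP => x; move/fsetP/(_ x): eI; rewrite -eU !inE.
  by case: (x \in rho); case: (x \in beta).
have : rho \in enum_fset (fpowerset alpha).
  by rewrite fpowersetE -eU fsubsetUl.
rewrite /Delta; elim: (enum_fset _) => // a l IH.
rewrite inE big_cons => /orP[/eqP<-|/IH h]; first exact: geq_minl.
exact: leq_trans (geq_minr _ _) h.
Qed.

End Minima.

(* Main.v *)
Require Import Defs.
From mathcomp Require Import all_boot all_order all_algebra finmap.
From mathcomp Require Import all_classical reals.
From mathcomp Require Import zify ring lra.

Set Implicit Arguments.
Unset Strict Implicit.
Unset Printing Implicit Defensive.

Import Order.TTheory GRing.Theory Num.Theory.

(* The threshold eps* is the largest distance from a point to its nearest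
   neighbour, since a graph has a star cover iff it has no isolated vertex. A
   star cover is grown greedily, and adjacent leaves of a star with at least
   three leaves are split off as an edge; then every star has at most five
   leaves, because six points of a disc of radius eps* cannot be at pairwise
   distances larger than eps*. The balances are now at most 4 and their sum is
   even, so signs with a sum of absolute value at most 2 exist as soon as some
   star has two, three or four leaves.

   Otherwise all stars have one or five leaves, and one looks for an exchange
   that creates a star with two, three or four leaves: move a leaf of a star
   with five leaves to a neighbour other than its center, or dissolve an edge
   x y of the cover and attach x to b and y to f, where b and f are not matched
   to each other. If there is none, every star with five leaves is a connected
   component, and every edge of the cover has an endpoint of degree one or lies
   on a component that is a cycle of length four; so all star covers have the
   same stars with five leaves and only edges besides. Then Delta is 0 or 4 for
   all of them, according to the parity of the number of these stars. *)

(** The quadratic bound shapes the proof: every phase is one double loop over pairs of points with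
    constant work per pair, so whatever a visit achieves has to survive all later visits. Attaching
    a vertex isolates no other one; splitting creates a star with one leaf and enlarges no other
    star; an exchange raises a flag, after which nothing more is claimed about exchanges. The
    exchange of an edge [x y] involves four points, too many to enumerate. Therefore one outside
    neighbour per point is tabulated, and only this one is tried for [y]: if every attempt fails,
    the outside neighbours of [x] and [y], when both have some, are the two ends of a single edge,
    and then no choice of [b] and [f] succeeds either. That a star with five leaves is a component
    comes from a second use of the disc argument: a further neighbour of its center is close to one
    of the leaves, which could then be moved. Comparisons use squared distances, as the machine has
    no square roots. *)

(** * Cost of loop-free commands and of counted loops *)

Section Machine.
Variable R : realType.
Implicit Types (s : state R) (c : cmd).

Fixpoint loop_free c : bool :=
  match c with
  | Seq c1 c2 | If _ c1 c2 => loop_free c1 && loop_free c2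
  | While _ _ => false
  | _ => true
  end.

(** [While] gets a dummy value: the link with [exec] is made under [loop_free] only. *)
Fixpoint den c s : state R :=
  match c with
  | Skip | While _ _ => s
  | NSet a i e => nupd s a (neval s i) (neval s e)
  | RSet a i e => rupd s a (neval s i) (reval s e)
  | Seq c1 c2 => den c2 (den c1 s)
  | If b c1 c2 => if beval s b then den c1 s else den c2 s
  end.

Fixpoint wcost c : nat :=
  match c with
  | Skip => 1
  | NSet _ i e => (ncost i + ncost e).+1
  | RSet _ i e => (ncost i + rcost e).+1
  | Seq c1 c2 => wcost c1 + wcost c2
  | If b c1 c2 => (bcost b + (wcost c1 + wcost c2)).+1
  | While _ _ => 0
  end.

Fixpoint nwrites a c : bool :=
  match c with
  | NSet b _ _ => b == a
  | Seq c1 c2 | If _ c1 c2 => nwrites a c1 || nwrites a c2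
  | _ => false
  end.

Lemma exec_den c s : loop_free c ->
  exists2 t, exec c s t (den c s) & (t <= wcost c)%N.
Proof.
elim: c s => //= [|a i e|a i e|c1 IH1 c2 IH2|b c1 IH1 c2 IH2] s.
- by move=> _; exists 1%N => //; constructor.
- by move=> _; exists (ncost i + ncost e).+1 => //; constructor.
- by move=> _; exists (ncost i + rcost e).+1 => //; constructor.
- move=> /andP[/(IH1 s)[t1 h1 l1] /(IH2 (den c1 s))[t2 h2 l2]].
  exists (t1 + t2)%N; last lia.
  by apply: ExecSeq h1 h2.
- move=> /andP[/(IH1 s)[t1 h1 l1] /(IH2 s)[t2 h2 l2]].
  have [hb|hb] := boolP (beval s b).
    exists (bcost b + t1).+1; last lia.
    exact: ExecIfTrue.
  exists (bcost b + t2).+1; last lia.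
  exact: ExecIfFalse.
Qed.

Lemma den_frame a c s : ~~ nwrites a c -> nmem (den c s) a = nmem s a.
Proof.
elim: c s => //= [b i e|c1 IH1 c2 IH2|b c1 IH1 c2 IH2] s.
- by rewrite /upd eq_sym => /negbTE ->.
- by rewrite negb_or => /andP[h1 h2]; rewrite IH2 // IH1.
- by rewrite negb_or => /andP[h1 h2]; case: ifP => _; rewrite ?IH1 ?IH2.
Qed.

Fixpoint rwrites c : bool :=
  match c with
  | RSet _ _ _ => true
  | Seq c1 c2 | If _ c1 c2 => rwrites c1 || rwrites c2
  | _ => false
  end.

Lemma den_rframe c s : ~~ rwrites c -> rmem (den c s) = rmem s.
Proof.
elim: c s => //= [c1 IH1 c2 IH2|b c1 IH1 c2 IH2] s.
- by rewrite negb_or => /andP[h1 h2]; rewrite IH2 // IH1.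
- by rewrite negb_or => /andP[h1 h2]; case: ifP => _; rewrite ?IH1 ?IH2.
Qed.

Definition var a := NGet a (NConst 0).

Definition loop_guard a := BNatLe (NAdd (var a) (NConst 1)) (var 0).

Definition loop_body a c :=
  Seq c (NSet a (NConst 0) (NAdd (var a) (NConst 1))).

Definition For a c :=
  Seq (NSet a (NConst 0) (NConst 0)) (While (loop_guard a) (loop_body a c)).

(** The 14 units per round are 7 for the guard, 6 for the increment and 1 for the [While] step; the
    extra round in the bound pays for the initialization and the failing guard. [I] is required
    after the update of the counter because it may speak of the whole memory. *)
Lemma for_exec a c n B (I : nat -> state R -> Prop) :
  a != 0%N ->
  (forall s i, (i < n)%N -> nmem s 0 0 = n -> nmem s a 0 = i -> I i s ->
     exists t s', [/\ exec c s t s', (t <= B)%N, nmem s' 0 0 = n,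
       nmem s' a 0 = i & I i.+1 (nupd s' a 0 i.+1)]) ->
  forall s, nmem s 0 0 = n -> I 0%N (nupd s a 0 0) ->
  exists t s', [/\ exec (For a c) s t s', (t <= (B + 14) * n.+1)%N,
    nmem s' 0 0 = n & I n s'].
Proof.
move=> a0 hc s hn hI.
have upd0 v (u : state R) : nmem (nupd u a 0 v) 0 0 = nmem u 0 0.
  by rewrite /= /upd eq_sym (negbTE a0).
have upda v (u : state R) : nmem (nupd u a 0 v) a 0 = v by rewrite /= /upd !eqxx.
have loop k i u : (i + k = n)%N -> nmem u 0 0 = n -> nmem u a 0 = i -> I i u ->
    exists t s', [/\ exec (While (loop_guard a) (loop_body a c)) u t s',
      (t <= (B + 14) * k + 8)%N, nmem s' 0 0 = n & I n s'].
  elim: k i u => [|k IH] i u ik un ui uI.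
    exists 8%N, u; split; rewrite ?muln0 //; last by rewrite -ik addn0.
    apply: (@ExecWhileFalse _ (loop_guard a)).
    by rewrite /= un ui; lia.
  have [|t [s' [e tB sn si sI]]] := hc u i _ un ui uI; first lia.
  have [|||//|t2 [s2 [e2 tB2 sn2 sI2]]] := IH i.+1 (nupd s' a 0 i.+1).
  - lia.
  - by rewrite upd0.
  - by rewrite upda.
  exists (7 + (t + 6) + t2).+1%N, s2; split=> //; last first.
    by rewrite mulnS; lia.
  apply: (@ExecWhileTrue _ (loop_guard a)) e2; first by rewrite /= un ui; lia.
  apply: ExecSeq e _.
  have := @ExecNSet _ a (NConst 0) (NAdd (var a) (NConst 1)) s'.
  by rewrite /= si -[i.+1]addn1.
have [//||//||t [s' [e tB sn sI]]] := loop n 0%N (nupd s a 0 0).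
- by rewrite upd0.
- exact: hI.
exists (3 + t)%N, s'; split=> //; last by rewrite mulnS; lia.
by apply: ExecSeq e; apply: (@ExecNSet _ a (NConst 0) (NConst 0)).
Qed.

Definition Pairs c := For 3 (For 4 c).

(* [P i j] is what the visit of the pair [(i, j)] achieves; it has to survive
   the later visits. *)
Lemma pairs_exec c n (J : state R -> Prop) (P : nat -> nat -> state R -> Prop) :
  loop_free c -> ~~ [|| nwrites 0 c, nwrites 3 c | nwrites 4 c] ->
  (forall s v, J s -> J (nupd s 3 0 v) /\ J (nupd s 4 0 v)) ->
  (forall i j s v, P i j s -> P i j (nupd s 3 0 v) /\ P i j (nupd s 4 0 v)) ->
  (forall s i j, (i < n)%N -> (j < n)%N -> nmem s 3 0 = i -> nmem s 4 0 = j ->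
     J s ->
     [/\ J (den c s), P i j (den c s) & forall i' j', (i' < n)%N -> (j' < n)%N ->
          P i' j' s -> P i' j' (den c s)]) ->
  forall s, nmem s 0 0 = n -> J s ->
  exists t s', [/\ exec (Pairs c) s t s', (t <= (wcost c + 28) * n.+1 ^ 2)%N,
    nmem s' 0 0 = n, J s' & forall i j, (i < n)%N -> (j < n)%N -> P i j s'].
Proof.
move=> lc /norP[w0 /norP[w3 w4]] hJ hP hc s sn sJ.
pose I i (u : state R) := J u /\ forall i' j, (i' < i)%N -> (j < n)%N -> P i' j u.
have [u i ilt un ui [uJ uP]||t [s' [e tB sn' [sJ' sP]]]] :=
  @for_exec 3 (For 4 c) n ((wcost c + 14) * n.+1) I isT _ s sn _; last first.
- exists t, s'; split=> //.
  by apply: leq_trans tB _; rewrite expnS expn1; nia.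
- by split=> //; exact: (hJ s 0%N sJ).1.
pose I2 j (v : state R) := [/\ J v, nmem v 3 0 = i, I i v &
   forall j', (j' < j)%N -> P i j' v].
have [v j jlt vn vj [vJ vi [_ vP] vP2]||t [s' [e tB sn' [sJ' si [_ sP] sP2]]]] :=
  @for_exec 4 c n (wcost c) I2 isT _ u un _; last first.
- exists t, s'; split=> //; split; first exact: (hJ s' i.+1 sJ').1.
  move=> i' j i'i jn; apply: (hP i' j s' i.+1 _).1.
  have [->|ne] := eqVneq i' i; first exact: sP2.
  by apply: sP => //; lia.
- split=> //; first exact: (hJ u 0%N uJ).2.
  split=> [|i' j i'i jn]; first exact: (hJ u 0%N uJ).2.
  exact: (hP i' j u 0%N (uP _ _ i'i jn)).2.
have [t ec tw] := exec_den v lc.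
have [dJ dP dS] := hc v i j ilt jlt vi vj vJ.
exists t, (den c v); split=> //; rewrite ?den_frame //.
have J' := (hJ _ j.+1 dJ).2.
split=> //.
- by rewrite /= /upd /= den_frame.
- split=> // i' j' i'i j'n; apply: (hP i' j' _ j.+1 _).2.
  by apply: dS => //; [lia | exact: vP].
- move=> j' j'j; apply: (hP i j' _ j.+1 _).2.
  have [->//|ne] := eqVneq j' j.
  by apply: dS => //; [lia | apply: vP2; lia].
Qed.

End Machine.

(** * Covers encoded by center functions, and their exchanges *)

Section Covers.
Variables (n : nat) (A : rel nat).
Hypothesis A_sym : forall i j, A i j -> A j i.
Hypothesis A_irr : forall i j, A i j -> i != j.
Implicit Types (C D : nat -> nat).

Definition setf (f : nat -> nat) i v := fun k => if k == i then v else f k.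

Definition deg C k := count (fun j => (j != k) && (C j == k)) (iota 0 n).

(* Isolated vertices [C i = i], [D i = 0] are allowed: they occur while the
   cover is being built or changed. *)
Definition valid C D := forall i, (i < n)%N ->
  [/\ (C i < n)%N, C (C i) = C i, C i != i -> A i (C i) & D i = deg C i].

(** Additions on both sides avoid truncated subtraction. *)
Lemma deg_setf C (i v k : nat) : (i < n)%N ->
  (deg (setf C i v) k + ((i != k) && (C i == k)) =
   deg C k + ((i != k) && (v == k)))%N.
Proof.
move=> ilt; rewrite /deg.
have -> : iota 0 n = iota 0 i ++ i :: iota i.+1 (n - i.+1).
  by rewrite -[i :: _]/(iota i (n - i.+1).+1) -iotaD; congr iota; lia.
rewrite !count_cat /= /setf eqxx.
have E (m q : nat) : i \notin iota m q ->
    count (fun j => (j != k) && ((if j == i then v else C j) == k)) (iota m q) =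
    count (fun j => (j != k) && (C j == k)) (iota m q).
  by move=> h; apply: eq_in_count => j jm; case: (eqVneq j i) => // e; rewrite -e jm in h.
have h1 : i \notin iota 0 i by rewrite mem_iota add0n ltnn andbF.
have h2 : i \notin iota i.+1 (n - i.+1) by rewrite mem_iota ltnn.
rewrite !E //; move: (count _ _) (count _ _) => a b.
by case: (i != k); case: (C i == k); case: (v == k) => /=; lia.
Qed.

Lemma deg_gt0 C j : (j < n)%N -> C j != j -> (0 < deg C (C j))%N.
Proof.
move=> jn cj; rewrite /deg -has_count; apply/hasP; exists j.
  by rewrite mem_iota.
by rewrite eqxx andbT eq_sym.
Qed.

Lemma valid_center C D k : valid C D -> (k < n)%N -> (0 < D k)%N -> C k = k.
Proof.
move=> V kn; have [_ _ _ ->] := V k kn.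
rewrite /deg -has_count => /hasP[j]; rewrite mem_iota /= add0n => jn.
by case/andP=> _ /eqP <-; have [] := V j jn.
Qed.

Lemma valid_leaf C D k : valid C D -> (k < n)%N -> C k != k ->
  D k = 0%N /\ (0 < D (C k))%N.
Proof.
move=> V kn ck; split.
  by case: (posnP (D k)) => // /(valid_center V kn) e; rewrite e eqxx in ck.
have [cn _ _ _] := V k kn; have [_ _ _ ->] := V (C k) cn.
exact: deg_gt0.
Qed.

Lemma leaf_exists C D k : valid C D -> (k < n)%N -> (0 < D k)%N ->
  exists j, [/\ (j < n)%N, j != k & C j = k].
Proof.
move=> V kn; have [_ _ _ ->] := V k kn.
rewrite /deg -has_count => /hasP[j]; rewrite mem_iota /= add0n => jn.
by case/andP=> jk /eqP cj; exists j.
Qed.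

Lemma leaf_unique C D j j' : valid C D -> (j < n)%N -> (j' < n)%N ->
  C j != j -> C j' != j' -> C j = C j' -> D (C j) = 1%N -> j = j'.
Proof.
move=> V jn j'n cj cj' e; have [cn _ _ _] := V j jn.
have [_ _ _ ->] := V _ cn => d1; apply/eqP/negP => ne.
(* Redirecting [j] to any value other than [C j] would leave [C j] without leaves, although [j']
   still is one. *)
have := deg_setf C (C j).+1 (C j) jn.
rewrite d1 eqxx andbT eq_sym cj; have -> : ((C j).+1 == C j) = false by lia.
rewrite andbF addn0 addn1 => -[/eqP]; rewrite -leqn0 leqNgt => /negP[].
have := @deg_gt0 (setf C j (C j).+1) j' j'n.
have jj' : (j' == j) = false by rewrite eq_sym; apply/negbTE/negP.
by rewrite /setf jj' -e; apply; rewrite e.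
Qed.

Definition link (s : (nat -> nat) * (nat -> nat)) i j :=
  (setf s.1 i j, setf s.2 j (s.2 j + 1)%N).

Definition detach (s : (nat -> nat) * (nat -> nat)) j :=
  if s.1 j == j then s else (setf s.1 j j, setf s.2 (s.1 j) (s.2 (s.1 j) - 1)%N).

(** Makes [j] a center. If [j] was the only leaf of its star, the edge is reversed, so that the old
    center is not left isolated. *)
Definition free_leaf (s : (nat -> nat) * (nat -> nat)) j :=
  if s.1 j == j then s
  else let s1 := detach s j in
       if s1.2 (s.1 j) == 0%N then link s1 (s.1 j) j else s1.

Definition attach (s : (nat -> nat) * (nat -> nat)) i j :=
  link (free_leaf s j) i j.

Lemma link_valid C D i j : valid C D -> (i < n)%N -> (j < n)%N -> A i j ->
  C i = i -> D i = 0%N -> C j = j -> valid (link (C, D) i j).1 (link (C, D) i j).2.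
Proof.
move=> V iltn jn Aij ci di cj k kn /=; have ij := A_irr Aij.
have [c1 c2 c3 c4] := V k kn.
have noi : C k = i -> k = i.
  move=> e; apply/eqP/negPn/negP => ki.
  have := @deg_gt0 C k kn; rewrite e eq_sym ki => /(_ isT).
  by have [_ _ _ <-] := V i iltn; rewrite di.
split.
- by rewrite /setf; case: ifP.
- rewrite /setf; case: (eqVneq k i) => [_|ki].
    by rewrite eq_sym (negbTE ij).
  by case: eqP => // /noi e; rewrite e eqxx in ki.
- by rewrite /setf; case: (eqVneq k i) => [->|_].
- have := deg_setf C j k iltn; rewrite ci /setf -c4 !(eq_sym _ k).
  case: (eqVneq k i) => [->|ki] /=.
    by rewrite (negbTE ij) !addn0.
  by case: eqP => [->|_]; lia.
Qed.

Lemma detach_valid C D j : valid C D -> (j < n)%N ->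
  valid (detach (C, D) j).1 (detach (C, D) j).2.
Proof.
move=> V jn; rewrite /detach /=; case: eqP => //= /eqP cj k kn.
have [c1 c2 c3 c4] := V k kn.
have [d1 d2 d3 d4] := V j jn.
split.
- by rewrite /setf; case: ifP.
- rewrite /setf; case: (eqVneq k j) => [_|kj]; first by rewrite eqxx.
  by case: eqP => // e; move: cj; rewrite -e c2 eqxx.
- by rewrite /setf; case: (eqVneq k j) => [->|//]; rewrite eqxx.
- have := deg_setf C j k jn; rewrite /setf -c4 !(eq_sym _ k).
  case: (eqVneq k j) => [->|kj] /=.
    by rewrite eq_sym (negbTE cj) !addn0.
  rewrite addn0; case: eqP => [e|_] /= h; rewrite -?e; lia.
Qed.

(** Three cases: [j] is a center; [j] is one of several leaves and starts a new star; [j] is the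
    leaf of a single edge, which is reversed, so that [j] ends with the two leaves [i] and its old
    center. *)
Lemma attach_spec C D i j : valid C D -> (i < n)%N -> (j < n)%N -> A i j ->
  C i = i -> D i = 0%N ->
  let C' := (attach (C, D) i j).1 in let D' := (attach (C, D) i j).2 in
  [/\ valid C' D',
      [/\ C' j = j, C' i = j & forall k, C' k = j \/ C' k = C k],
      forall k, (k < n)%N -> k != i -> C k != C j -> C' k = C k /\ D' k = D k,
      forall k, (k < n)%N -> C' k = k -> D' k = 0%N ->
        [/\ C k = k, D k = 0%N & k != i] &
      [/\ forall k, k != j -> (D' k <= D k)%N,
          D' j = (if C j == j then (D j).+1 else if D (C j) == 1 then 2 else 1)%N &
          C j != j -> D' (C j) = (D (C j) - 1)%N]].
Proof.
move=> V iltn jn Aij ci di; have ij := A_irr Aij.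
have [cn ccj Ajc _] := V j jn.
rewrite /attach /free_leaf /=; case: eqP => [cj|/eqP cj].
  have V' := link_valid V iltn jn Aij ci di cj.
  split=> //=.
  - by rewrite /setf eqxx cj [j == i]eq_sym (negbTE ij); split=> // k; case: ifP; auto.
  - move=> k kn /negbTE ki; rewrite cj /setf ki => ck; case: (eqVneq k j) ck => // ->.
    by rewrite cj eqxx.
  - move=> k kn; rewrite /setf; case: eqP => [->|_]; first by move=> e; rewrite e eqxx in ij.
    by case: eqP => [->|] //; lia.
  - split=> // [k /negbTE kj|]; rewrite /setf ?kj // eqxx addn1 //.
have [dj dc] := valid_leaf V jn cj.
have ic : i != C j by apply: contraTneq dc => <-; rewrite di.
have cj' : (j == C j) = false by rewrite eq_sym (negbTE cj).
have ij' : (j == i) = false by rewrite eq_sym (negbTE ij).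
have ic' : (C j == i) = false by rewrite eq_sym (negbTE ic).
have V1 := detach_valid V jn; move: V1; rewrite /detach /= (negbTE cj) /=.
set C1 := setf C j j; set D1 := setf D _ _ => V1.
have C1j : C1 j = j by rewrite /C1 /setf eqxx.
have C1i : C1 i = i by rewrite /C1 /setf (negbTE ij).
have D1i : D1 i = 0%N by rewrite /D1 /setf (negbTE ic).
have D1c : D1 (C j) = (D (C j) - 1)%N by rewrite /D1 /setf eqxx.
rewrite D1c; case: eqP => [d1|/eqP d1]; last first.
  have V' := link_valid V1 iltn jn Aij C1i D1i C1j.
  split=> //=.
  - rewrite /setf eqxx ij' C1j; split=> // k; case: ifP; auto => _.
    by rewrite /C1 /setf; case: ifP; auto.
  - move=> k kn /negbTE ki kc.
    have kj : (k == j) = false by apply: contraNF kc => /eqP ->.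
    have kcj : (k == C j) = false.
      by apply: contraNF kc => /eqP ->; rewrite ccj.
    by rewrite /setf ki kj /C1 /setf kj /D1 /setf kcj.
  - move=> k kn; rewrite /setf /C1 /D1 /setf.
    case: eqP => [->|/eqP ki]; first by move=> e; rewrite e eqxx in ij.
    case: eqP => [->|kj ck]; first lia.
    case: eqP => [->|//]; lia.
  - split=> [k /negbTE kj||_].
    + by rewrite /setf kj /D1 /setf; case: eqP => // ->; lia.
    + rewrite /setf eqxx /D1 /setf cj' dj; case: eqP => // e.
      by rewrite e in d1.
    + by rewrite /setf (negbTE cj) D1c.
have C1c : C1 (C j) = C j by rewrite /C1 /setf (negbTE cj).
have V2 := link_valid V1 cn jn (A_sym (Ajc cj)) C1c _ C1j.
have {}V2 := V2 (etrans D1c d1).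
move: V2; rewrite /link /=; set C2 := setf C1 _ _; set D2 := setf D1 _ _ => V2.
have C2j : C2 j = j by rewrite /C2 /setf cj'.
have C2i : C2 i = i by rewrite /C2 /setf (negbTE ic).
have D2i : D2 i = 0%N by rewrite /D2 /setf (negbTE ij).
have V' := link_valid V2 iltn jn Aij C2i D2i C2j.
have dc1 : D (C j) = 1%N by lia.
split=> //=.
- rewrite /setf eqxx ij' C2j; split=> // k; case: ifP; auto => _.
  rewrite /C2 /setf; case: ifP; auto => _.
  by rewrite /C1 /setf; case: ifP; auto.
- move=> k kn /negbTE ki kc.
  have kj : (k == j) = false by apply: contraNF kc => /eqP ->.
  have kcj : (k == C j) = false.
    by apply: contraNF kc => /eqP ->; rewrite ccj.
  by rewrite /setf ki kj /C2 /setf kcj /C1 /setf kj /D2 /setf kj /D1 /setf kcj.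
- move=> k kn; rewrite /setf /C2 /D2 /setf.
  case: eqP => [->|/eqP ki]; first by move=> e; rewrite e eqxx in ij.
  case: eqP => [->|kc]; first by move=> /eqP; rewrite cj'.
  case: eqP => [->|kj]; first lia.
  by rewrite /C1 /D1 /setf; do 2! case: eqP => //.
- split=> [k /negbTE kj||_].
  + by rewrite /setf kj /D2 /setf kj /D1 /setf; case: eqP => // ->; lia.
  + by rewrite /setf eqxx /D2 /setf eqxx /D1 /setf cj' dj dc1.
  + by rewrite /setf (negbTE cj) /D2 /setf (negbTE cj) D1c.
Qed.

Definition covering C D :=
  valid C D /\ forall k, (k < n)%N -> C k = k -> (0 < D k)%N.

Definition move s i j := attach (detach s i) i j.

Lemma detach_leafE C D i : C i != i ->
  detach (C, D) i = (setf C i i, setf D (C i) (D (C i) - 1)%N).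
Proof. by rewrite /detach /= => /negbTE ->. Qed.

Lemma setfE f i v : setf f i v i = v.
Proof. by rewrite /setf eqxx. Qed.

Lemma setf_ne f i v k : k != i -> setf f i v k = f k.
Proof. by rewrite /setf => /negbTE ->. Qed.

(** Detaching [i] lowers only the count of its old center, which keeps a leaf; [attach] then
    isolates nothing. *)
Lemma move_covering C D i j : covering C D -> (i < n)%N -> (j < n)%N -> A i j ->
  C i != i -> (1 < D (C i))%N ->
  covering (move (C, D) i j).1 (move (C, D) i j).2.
Proof.
move=> [V N] iltn jn Aij ci di; rewrite /move.
have := detach_valid V iltn; rewrite detach_leafE //=.
set C1 := setf C _ _; set D1 := setf D _ _ => V1.
have [Di0 _] := valid_leaf V iltn ci.
have D1i : D1 i = 0%N by rewrite /D1 setf_ne // eq_sym.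
have [V' _ _ S _] := attach_spec V1 iltn jn Aij (setfE _ _ _) D1i.
split=> // k kn ck; rewrite lt0n; apply/negP => /eqP dk.
have [c1 d1 ki] := S _ kn ck dk.
move: c1; rewrite /C1 setf_ne // => c1; have := N k kn c1.
by move: d1; rewrite /D1 /setf; case: eqP => [->|_ ->//]; lia.
Qed.

(** With at least three leaves, the old center keeps one after [i] and [j] have left; with two,
    [attach] would merely reverse the remaining edge. The last clauses make splitting stable under
    later visits. *)
Lemma split_spec C D i j : covering C D -> (i < n)%N -> (j < n)%N -> A i j ->
  C i = C j -> C i != i -> C j != j -> (2 < D (C i))%N ->
  let C' := (move (C, D) i j).1 in let D' := (move (C, D) i j).2 in
  [/\ covering C' D', forall k, C' k = j \/ C' k = C k, D' j = 1%N &
      forall k, k != j -> (D' k <= D k)%N].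
Proof.
move=> H iltn jn Aij cc ci cj di C' D'; have H' := move_covering H iltn jn Aij ci (ltnW di).
split=> //; rewrite /C' /D' {C' D' H'}; have [V N] := H; have ij := A_irr Aij.
all: have V1 := detach_valid V iltn; rewrite /move; rewrite detach_leafE // in V1 *.
all: rewrite /= in V1.
all: set C1 := setf C _ _ in V1 *; set D1 := setf D _ _ in V1 *.
all: have [Di0 _] := valid_leaf V iltn ci.
all: have D1i : D1 i = 0%N by rewrite /D1 setf_ne // eq_sym.
all: have [_ [Cj Ci Ck] _ _ [Dk Dj Dc]] := attach_spec V1 iltn jn Aij (setfE _ _ _) D1i.
all: have C1j : C1 j = C j by rewrite /C1 setf_ne // eq_sym.
- move=> k; case: (eqVneq k i) => [->|ki]; first by left.
  by case: (Ck k) => ->; [left | right; rewrite /C1 setf_ne].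
- rewrite Dj C1j (negbTE cj) -cc /D1 setfE; case: eqP => //; lia.
- move=> k kj; apply: leq_trans (Dk _ kj) _.
  by rewrite /D1 /setf; case: eqP => [->|//]; lia.
Qed.

Definition small D := forall k, (k < n)%N -> (D k <= 5)%N.
Definition midstar D := exists2 k, (k < n)%N & (1 < D k < 5)%N.

Lemma move_spec C D i j : covering C D -> (i < n)%N -> (j < n)%N -> A i j ->
  small D -> ~ midstar D -> C i != i -> D (C i) = 5%N -> j != C i ->
  ~ (C j = j /\ D j = 5%N) ->
  let C' := (move (C, D) i j).1 in let D' := (move (C, D) i j).2 in
  [/\ covering C' D', small D' & midstar D'].
Proof.
move=> H iltn jn Aij s5 nmid ci di jc jj C' D'.
have H' : covering C' D' by apply: move_covering => //; rewrite di.
split=> //; rewrite /C' /D' {C' D' H'}; have [V N] := H; have ij := A_irr Aij.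
all: have V1 := detach_valid V iltn; rewrite /move; rewrite detach_leafE // in V1 *.
all: rewrite /= in V1.
all: set C1 := setf C _ _ in V1 *; set D1 := setf D _ _ in V1 *.
all: have [Di0 _] := valid_leaf V iltn ci.
all: have D1i : D1 i = 0%N by rewrite /D1 setf_ne // eq_sym.
all: have D1c : D1 (C i) = 4%N by rewrite /D1 setfE di.
all: have [_ [Cj Ci Ck] Fk _ [Dk Dj Dc]] := attach_spec V1 iltn jn Aij (setfE _ _ _) D1i.
all: have C1j : C1 j = j -> C j = j by rewrite /C1 setf_ne // eq_sym.
all: have D1k k : (D1 k <= D k)%N by rewrite /D1 /setf; case: eqP => [->|//]; lia.
- move=> k kn; case: (eqVneq k j) => [->|kj].
    rewrite Dj; case: eqP => [/C1j cj|_]; last by case: ifP.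
    have : (D j <> 5)%N by move=> e; apply: jj.
    by have := D1k j; have := s5 j jn; lia.
  exact: leq_trans (Dk k kj) (leq_trans (D1k k) (s5 k kn)).
have [cn cci _ _] := V i iltn.
(* The star that loses [i] keeps four leaves, or three if [j] was a leaf of it too. *)
exists (C i) => //.
have C1c : C1 (C i) = C i by rewrite /C1 setf_ne.
case: (eqVneq (C1 j) (C i)) => [e|ne].
  by rewrite -e Dc; [rewrite e D1c | rewrite e eq_sym].
by rewrite (Fk _ cn ci _).2 ?D1c // C1c eq_sym.
Qed.

(** One of the two points is the center of the edge: [detach] does nothing to it, and resets its
    count when applied to the other point. *)
Lemma detach2E C D x y : valid C D -> (x < n)%N -> (y < n)%N ->
  y != x -> C y = C x -> D (C x) = 1%N ->
  let C1 := (detach (detach (C, D) x) y).1 in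
  let D1 := (detach (detach (C, D) x) y).2 in
  [/\ valid C1 D1, [/\ C1 x = x, C1 y = y, D1 x = 0%N & D1 y = 0%N] &
      forall k, k != x -> k != y -> C1 k = C k /\ D1 k = D k].
Proof.
move=> V xn yn yx cyx d1 C1 D1.
have V1 : valid C1 D1.
  have := detach_valid V xn; rewrite /C1 /D1.
  by case: (detach (C, D) x) => ? ? /detach_valid; apply.
have yx' : (x == y) = false by rewrite eq_sym (negbTE yx).
split=> //; rewrite /C1 /D1 {C1 D1 V1} /detach /=.
all: case: (eqVneq (C x) x) => /= cx.
- have dy : D y = 0%N by have [] := valid_leaf V yn; rewrite // cyx cx yx'.
  rewrite cyx cx yx' /= /setf yx' !eqxx (negbTE yx) dy.
  by have -> : D x = 1%N by rewrite -d1 cx.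
- have cy : C y = y.
    apply/eqP/negPn/negP => cy; have := leaf_unique V yn xn cy cx cyx.
    by rewrite cyx => /(_ d1) e; rewrite e eqxx in yx.
  have dx : D x = 0%N by have [] := valid_leaf V xn cx.
  rewrite -cyx cy /= /setf (negbTE yx) cy !eqxx /= eqxx yx' dx cy.
  by rewrite (negbTE yx) eqxx; have -> : D y = 1%N by rewrite -d1 -cyx cy.
- by move=> k kx ky; rewrite cyx cx yx' /= !setf_ne.
- have cy : C y = y.
    apply/eqP/negPn/negP => cy; have := leaf_unique V yn xn cy cx cyx.
    by rewrite cyx => /(_ d1) e; rewrite e eqxx in yx.
  move=> k kx ky; rewrite -cyx cy setf_ne // cy eqxx /= !setf_ne //.
Qed.

(** Attaching [x] gives [b] two leaves, [x] and its old partner. If [e] is [b], it gets a third one;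
    if [e] is on another edge, it becomes a center with two leaves. The disjunction excludes that
    [e] is the partner of [b], where two edges would result again. *)
Lemma rewire_spec C D x y b e : covering C D ->
  (x < n)%N -> (y < n)%N -> (b < n)%N -> (e < n)%N -> A x b -> A y e ->
  small D -> y != x -> C y = C x -> D (C x) = 1%N ->
  C b != C x -> D (C b) = 1%N -> C e != C y -> D (C e) = 1%N ->
  (b == e) || (C b != C e) ->
  let s' := attach (attach (detach (detach (C, D) x) y) x b) y e in
  [/\ covering s'.1 s'.2, small s'.2 & midstar s'.2].
Proof.
move=> [V N] xn yn bn en Axb Aye s5 yx cyx dx cb db ce de be s'; rewrite {}/s'.
have := detach2E V xn yn yx cyx dx.
case: (detach (detach (C, D) x) y) => C1 D1 SS; rewrite /= in SS.
case: SS => V1 [C1x C1y D1x D1y] F1.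
have ccx z : (z < n)%N -> C z != C x -> [/\ C1 z = C z, D1 z = D z & D1 (C z) = D (C z)].
  move=> zn cz; have [_ cc _ _] := V z zn.
  have zx : z != x by apply: contraNneq cz => ->.
  have zy : z != y by apply: contraNneq cz => ->; rewrite cyx.
  have czx : C z != x by apply: contraNneq cz => h; rewrite -cc h.
  have czy : C z != y by apply: contraNneq cz => h; rewrite -cc h cyx.
  by have [-> ->] := F1 z zx zy; have [_ ->] := F1 _ czx czy.
have [C1b D1b D1cb] := ccx b bn cb.
have ce' : C e != C x by rewrite -cyx.
have [C1e D1e D1ce] := ccx e en ce'.
have := attach_spec V1 xn bn Axb C1x D1x.
case: (attach (C1, D1) x b) => C2 D2 SS; rewrite /= in SS.
case: SS => V2 [C2b _ _] F2 S2 [D2k D2b _].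
have {}D2b : D2 b = 2%N.
  rewrite D2b C1b D1cb db; case: eqP => // cbb.
  by rewrite D1b -{1}cbb db.
have [_ ccb _ _] := V b bn.
have [C2y D2y] : C2 y = y /\ D2 y = 0%N.
  rewrite -{2}C1y -D1y; apply: F2 => //.
  by rewrite C1y C1b; apply: contraNneq cb => h; rewrite -ccb -h cyx.
have := attach_spec V2 yn en Aye C2y D2y.
case: (attach (C2, D2) y e) => C3 D3 /= [V3 _ _ S3 [D3k D3e _]].
have {}D3e : (1 < D3 e < 4)%N.
  rewrite D3e; case: (eqVneq b e) be => [<- _|nbe /= cbe].
    by rewrite C2b eqxx D2b.
  have [_ cce _ _] := V e en; have [cen _ _ _] := V e en.
  have ex : e != x by apply: contraNneq ce' => ->.
  have cex : C e != x by apply: contraNneq ce' => h; rewrite -cce h.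
  have cexx : C (C e) != C x by rewrite cce.
  have [C2e D2e] : C2 e = C1 e /\ D2 e = D1 e.
    by apply: F2 => //; rewrite C1e C1b eq_sym.
  have [_ D2ce] : C2 (C e) = C1 (C e) /\ D2 (C e) = D1 (C e).
    by have [c1 _ _] := ccx _ cen cexx; apply: F2; rewrite // C1b c1 cce eq_sym.
  rewrite C2e C1e D2ce D1ce de; case: eqP => // cee.
  by rewrite D2e D1e -{1}cee de -{1}cee de.
have D12 k : (k < n)%N -> (D1 k <= 5)%N.
  move=> kn; case: (eqVneq k x) => [->|kx]; first by rewrite D1x.
  case: (eqVneq k y) => [->|ky]; first by rewrite D1y.
  by have [_ ->] := F1 k kx ky; apply: s5.
split; last by exists e => //; case/andP: D3e => -> h2; exact: leq_trans h2 _.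
- split=> // k kn ck; rewrite lt0n; apply/negP => /eqP dk.
  have [{}ck {}dk ky] := S3 k kn ck dk.
  have [{}ck {}dk kx] := S2 k kn ck dk.
  have [c1 d1] := F1 k kx ky; rewrite c1 in ck; rewrite d1 in dk.
  by have := N k kn ck; rewrite dk.
- move=> k kn; case: (eqVneq k e) => [->|ke].
    by case/andP: D3e => _ h2; exact: leq_trans (ltnW h2) _.
  apply: leq_trans (D3k k ke) _.
  case: (eqVneq k b) => [->|kb]; first by rewrite D2b.
  exact: leq_trans (D2k k kb) (D12 k kn).
Qed.

Lemma attach_isolated C D i j : valid C D -> (i < n)%N -> (j < n)%N -> A i j ->
  C i = i -> D i = 0%N ->
  let C' := (attach (C, D) i j).1 in let D' := (attach (C, D) i j).2 in
  [/\ valid C' D', C' i != i &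
      forall k, (k < n)%N -> C' k = k -> D' k = 0%N -> C k = k /\ D k = 0%N].
Proof.
move=> V iltn jn Aij ci di.
have [V' [_ Ci _] _ S _] := attach_spec V iltn jn Aij ci di.
split=> //; first by rewrite Ci eq_sym A_irr.
by move=> k kn ck dk; have [] := S k kn ck dk.
Qed.

End Covers.

(** * Six points in a disc *)

Section Kissing.
Variable R : realType.
Implicit Types (u v w c : plane R) (e s t : R).
Local Open Scope ring_scope.

Definition sqdist u v : R :=
  (u.1 - v.1) * (u.1 - v.1) + (u.2 - v.2) * (u.2 - v.2).

Lemma sqdistC u v : sqdist u v = sqdist v u.
Proof. by rewrite /sqdist; ring. Qed.

Lemma sqdist_ge0 u v : 0 <= sqdist u v.
Proof. by rewrite /sqdist -!expr2 addr_ge0 ?sqr_ge0. Qed.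

(* The squared length of the vector with coordinates [s], [t] in a basis of two
   unit vectors at an angle of 60 degrees. *)
Definition hexnorm s t : R := s ^+ 2 + s * t + t ^+ 2.

Lemma hexnorm_mono s t s' t' : 0 <= s -> s <= s' -> 0 <= t -> t <= t' ->
  hexnorm s t <= hexnorm s' t'.
Proof. by rewrite /hexnorm => *; nra. Qed.

(** If one point dominates the other in both coordinates, monotonicity suffices. Otherwise the
    coordinates of the difference have opposite signs, and the negative mixed term outweighs the
    smaller square. *)
Lemma sector_close s t s' t' e : 0 <= s -> 0 <= t -> 0 <= s' -> 0 <= t' ->
  hexnorm s t <= e -> hexnorm s' t' <= e -> hexnorm (s - s') (t - t') <= e.
Proof.
move=> s0 t0 s0' t0' h h'.
have sym x y : hexnorm (- x) (- y) = hexnorm x y by rewrite /hexnorm; ring.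
have opp x y : 0 <= x -> 0 <= y -> hexnorm x (- y) <= Num.max (x ^+ 2) (y ^+ 2).
  move=> x0 y0; rewrite le_max /hexnorm.
  by case: (leP x y) => xy; apply/orP; [right | left]; nra.
have low x y : 0 <= x -> 0 <= y -> Num.max (x ^+ 2) (y ^+ 2) <= hexnorm x y.
  by move=> x0 y0; rewrite ge_max /hexnorm; apply/andP; split; nra.
have mix a b a' b' : 0 <= a -> 0 <= b' -> a' <= a -> b <= b' -> 0 <= a' ->
    0 <= b -> hexnorm a b <= e -> hexnorm a' b' <= e ->
    hexnorm (a - a') (b - b') <= e.
  move=> a0 b0' aa bb a0' b0 hab hab'.
  rewrite -(opprB b' b); apply: le_trans (opp _ _ _ _) _; rewrite ?subr_ge0 //.
  rewrite ge_max; apply/andP; split.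
    by apply: le_trans hab; rewrite /hexnorm; nra.
  by apply: le_trans hab'; rewrite /hexnorm; nra.
case: (leP s s') => ss; case: (leP t t') => tt.
- by rewrite -sym !opprB; apply: le_trans h'; apply: hexnorm_mono; lra.
- rewrite -sym !opprB; apply: mix => //; exact: ltW.
- by apply: mix => //; exact: ltW.
- by apply: le_trans h; apply: hexnorm_mono; lra.
Qed.

(* The first vector lies on the boundary of two of the six sectors of 60
   degrees, and none of the other five is in these two: so two of them share
   one of the four remaining sectors. *)
Lemma no_six_neighbours c e (l : seq (plane R)) : uniq l -> (5 < size l)%N ->
  (forall u, u \in l -> sqdist c u <= e) ->
  (forall u v, u \in l -> v \in l -> u != v -> e < sqdist u v) -> False.
Proof.
case: l => // w l /= /andP[wl ul]; rewrite ltnS => sl near far.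
have [a [b [ea eb]]] : exists a b, a = w.1 - c.1 /\ b = w.2 - c.2.
  by exists (w.1 - c.1), (w.2 - c.2).
pose r := a ^+ 2 + b ^+ 2.
have rE : r = sqdist c w by rewrite /r ea eb /sqdist; ring.
(* [p] and [q] are the scalar and the cross product with [w - c]; [s] and [t] are [r] times the
   coordinates in the basis of [w - c] and its rotation by 60 degrees. This scaling avoids a
   division by [r]. *)
pose k : R := Num.sqrt (3^-1).
have k3 : k ^+ 2 = 3^-1 by rewrite sqr_sqrtr // invr_ge0.
pose p u := a * (u.1 - c.1) + b * (u.2 - c.2).
pose q u := a * (u.2 - c.2) - b * (u.1 - c.1).
pose s u := p u - k * q u.
pose t u := 2 * k * q u.
have st x y : hexnorm (x - k * y) (2 * k * y) = x ^+ 2 + y ^+ 2.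
  have -> : hexnorm (x - k * y) (2 * k * y) = x ^+ 2 + 3 * k ^+ 2 * y ^+ 2.
    by rewrite /hexnorm; ring.
  by rewrite k3; field.
have stE u : hexnorm (s u) (t u) = r * sqdist c u.
  by rewrite st /p /q /r /sqdist; ring.
have stB u v : hexnorm (s u - s v) (t u - t v) = r * sqdist u v.
  have -> : s u - s v = (p u - p v) - k * (q u - q v) by rewrite /s; ring.
  have -> : t u - t v = 2 * k * (q u - q v) by rewrite /t; ring.
  by rewrite st /p /q /r /sqdist; ring.
have sw : s w = r by rewrite /s /p /q /r -ea -eb; ring.
have tw : t w = 0 by rewrite /t /q -ea -eb; ring.
have nearr u : u \in w :: l -> hexnorm (s u) (t u) <= r * e.
  by move=> ul'; rewrite stE ler_wpM2l ?near // rE sqdist_ge0.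
have [v0 v0l] : exists v, v \in l.
  by case: (l) sl => // v0 l' _; exists v0; rewrite inE eqxx.
(* If [w] were [c], every other point of the list would be too close to it. *)
have r0 : 0 < r.
  rewrite lt_neqAle eq_sym rE sqdist_ge0 andbT -rE; apply/eqP => r0.
  have a0 : a = 0 by move: r0; rewrite /r; nra.
  have b0 : b = 0 by move: r0; rewrite /r; nra.
  have := far w v0; rewrite !inE eqxx v0l orbT => /(_ isT isT).
  have -> : w != v0 by apply: contraNneq wl => ->.
  have -> : sqdist w v0 = sqdist c v0.
    rewrite /sqdist; have -> : w.1 = c.1 by lra.
    by have -> : w.2 = c.2 by lra.
  by move=> /(_ isT); rewrite ltNge near // inE v0l orbT.
have farr u v : u \in w :: l -> v \in w :: l -> u != v ->
    r * e < hexnorm (s u - s v) (t u - t v).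
  by move=> ul' vl' uv; rewrite stB ltr_pM2l // far.
have wwl : w \in w :: l by rewrite inE eqxx.
have out u : u \in l -> ~ (0 <= s u /\ 0 <= t u) /\ ~ (0 <= s u + t u /\ t u <= 0).
  move=> ul'; have uwl : u \in w :: l by rewrite inE ul' orbT.
  have uw : u != w by apply: contraNneq wl => <-.
  have hu := nearr u uwl; have hw := nearr w wwl; rewrite sw tw in hw.
  have := farr u w uwl wwl uw; rewrite sw tw => hf.
  split=> -[h1 h2]; move: hf; rewrite ltNge => /negP; apply.
    by apply: sector_close => //; lra.
  have -> : hexnorm (s u - r) (t u - 0) = hexnorm ((s u + t u) - r) (- t u - 0).
    by rewrite /hexnorm; ring.
  apply: sector_close; rewrite ?oppr_ge0 ?(ltW r0) //.
  by have -> : hexnorm (s u + t u) (- t u) = hexnorm (s u) (t u) by rewrite /hexnorm; ring.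
pose sec u := if 0 <= t u then (if 0 <= s u + t u then 0%N else 1%N)
              else (if s u <= 0 then 2%N else 3%N).
have inj : {in l &, injective sec}.
  move=> u v ul' vl' es; apply/eqP/negPn/negP => uv.
  have uwl : u \in w :: l by rewrite inE ul' orbT.
  have vwl : v \in w :: l by rewrite inE vl' orbT.
  have := farr u v uwl vwl uv; rewrite ltNge => /negP; apply.
  have hu := nearr u uwl; have hv := nearr v vwl.
  have [ou1 ou2] := out u ul'; have [ov1 ov2] := out v vl'.
  (* A rotation by 60 degrees and the half turn; such isometries carry each of the four sectors to
     the one with nonnegative coordinates. *)
  have rot x y : hexnorm x y = hexnorm (x + y) (- x) by rewrite /hexnorm; ring.
  have neg x y : hexnorm x y = hexnorm (- x) (- y) by rewrite /hexnorm; ring.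
  have close x y x' y' : 0 <= x -> 0 <= y -> 0 <= x' -> 0 <= y' ->
      hexnorm x y = hexnorm (s u) (t u) -> hexnorm x' y' = hexnorm (s v) (t v) ->
      hexnorm (s u - s v) (t u - t v) = hexnorm (x - x') (y - y') ->
      hexnorm (s u - s v) (t u - t v) <= r * e.
    move=> x0 y0 x0' y0' e1 e2 ->; apply: sector_close; rewrite ?e1 ?e2 //.
  have neg_s z : ~ (0 <= s z /\ 0 <= t z) -> 0 <= t z -> 0 <= - s z.
    move=> oz tz; rewrite oppr_ge0 leNgt; apply/negP => sz.
    by apply: oz; split=> //; exact: ltW.
  have neg_st z : ~ (0 <= s z + t z /\ t z <= 0) -> t z < 0 -> 0 <= - (s z + t z).
    move=> oz tz; rewrite oppr_ge0 leNgt; apply/negP => sz.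
    by apply: oz; split; exact: ltW.
  move: es; rewrite /sec.
  case: (leP 0 (t u)) => tu; case: (leP 0 (t v)) => tv.
  - case: (leP 0 (s u + t u)) => stu; case: (leP 0 (s v + t v)) => stv // _.
      apply: (close (s u + t u) (- s u) (s v + t v) (- s v)); rewrite -?rot //;
        by [exact: neg_s | rewrite rot; congr hexnorm; ring].
    apply: (close (t u) (- (s u + t u)) (t v) (- (s v + t v))) => //;
      by [lra | rewrite /hexnorm; ring].
  - by case: ifP => _; case: ifP.
  - by case: ifP => _; case: ifP.
  - case: (leP (s u) 0) => su; case: (leP (s v) 0) => sv // _.
      apply: (close (- s u) (- t u) (- s v) (- t v)); rewrite -?neg //;
        by [lra | rewrite neg; congr hexnorm; ring].
    apply: (close (- (s u + t u)) (s u) (- (s v + t v)) (s v)); 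
      by [exact: neg_st | exact: ltW | rewrite /hexnorm; ring].
suff: (size (map sec l) <= size (iota 0 4))%N by rewrite size_map size_iota leqNgt sl.
apply: uniq_leq_size; first by rewrite map_inj_in_uniq.
move=> x /mapP[u _ ->]; rewrite mem_iota /sec.
by do 2! case: ifP => _ //.
Qed.

End Kissing.

(** * Signed sums of bounded weights *)

Section Signs.
Variables (T : choiceType) (w : T -> int).
Implicit Types (g : T -> bool) (s : seq T).
Local Open Scope ring_scope.

Definition signed_sum g s : int := \sum_(x <- s) (if g x then w x else - w x).

Lemma signed_sumN g s : signed_sum (fun x => ~~ g x) s = - signed_sum g s.
Proof.
by rewrite /signed_sum -sumrN; apply: eq_bigr => x _; case: (g x); rewrite ?opprK.
Qed.

Lemma eq_signed_sum g g' s : {in s, g =1 g'} -> signed_sum g s = signed_sum g' s.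
Proof. by move=> h; apply: eq_big_seq => x /h ->. Qed.

Lemma signed_sum_flip g x s : uniq s -> x \in s ->
  signed_sum (fun y => (y == x) (+) g y) s =
  signed_sum g s - (if g x then w x else - w x) *+ 2.
Proof.
move=> us xs; rewrite /signed_sum !(bigD1_seq x xs us) /= eqxx.
have -> : \sum_(i <- s | i != x) (if (i == x) (+) g i then w i else - w i) =
   \sum_(i <- s | i != x) (if g i then w i else - w i).
  by apply: eq_bigr => y /negbTE ->.
by case: (g x) => /=; ring.
Qed.

(** Each further weight gets the sign opposing the sum formed so far. *)
Lemma signs_le m s : uniq s -> (forall x, x \in s -> 0 <= w x <= m) -> 0 <= m ->
  exists g, `|signed_sum g s| <= m.
Proof.
move=> us ws m0; elim: s us ws => [_ _|x s IH /= /andP[xs us] ws].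
  by exists xpredT; rewrite /signed_sum big_nil.
have [|g hg] := IH us; first by move=> y ys; apply: ws; rewrite inE ys orbT.
have wx := ws x (mem_head _ _).
pose g' y := if y == x then signed_sum g s <= 0 else g y.
have e : signed_sum g' s = signed_sum g s.
  apply: eq_signed_sum => y ys; rewrite /g'; case: eqP => // yx.
  by rewrite -yx ys in xs.
exists g'; rewrite /signed_sum big_cons -/(signed_sum g' s) e /g' eqxx.
by case: ifP; lia.
Qed.

Lemma signed_sum_parity g s : exists k, signed_sum g s = \sum_(x <- s) w x + k *+ 2.
Proof.
rewrite /signed_sum; elim: s => [|x s [k IH]]; first by exists 0; rewrite !big_nil.
rewrite !big_cons IH; case: (g x); first by exists k; ring.
by exists (k - w x); ring.
Qed.

Lemma signed_sum_dvd d g s : (forall x, x \in s -> w x = d) ->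
  exists k, signed_sum g s = d * k.
Proof.
move=> h; rewrite /signed_sum big_seq.
elim/big_ind: _ => [|_ _ [k ->] [l ->]|x /h ->].
- by exists 0; rewrite mulr0.
- by exists (k + l); rewrite mulrDr.
- by case: ifP => _; [exists 1; rewrite mulr1 | exists (- 1); rewrite mulrN1].
Qed.

(* Balance the weights 4 and the other ones separately; if the latter cancel
   out, flipping the sign of [x] yields a sum that compensates a 4. *)
Lemma signs_mid s x : uniq s -> (forall y, y \in s -> 0 <= w y <= 4) ->
  x \in s -> 0 < w x < 4 -> (exists k, \sum_(y <- s) w y = k *+ 2) ->
  exists g, `|signed_sum g s| <= 2.
Proof.
move=> us ws xs wx [k0 even].
pose sF := [seq y <- s | w y == 4]; pose sR := [seq y <- s | w y != 4].
have glue g g' : exists h, signed_sum h s = signed_sum g sF + signed_sum g' sR.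
  exists (fun y => if w y == 4 then g y else g' y).
  rewrite {1}/signed_sum (bigID (fun y => w y == 4)) /= /signed_sum !big_filter.
  by congr (_ + _); apply: eq_bigr => y; [move=> -> | move=> /negbTE ->].
have [gF hF] : exists g, `|signed_sum g sF| <= 4.
  by apply: signs_le; rewrite ?filter_uniq // => y; rewrite mem_filter => /andP[_ /ws].
have [gR hR] : exists g, `|signed_sum g sR| <= 3.
  apply: signs_le; rewrite ?filter_uniq // => y; rewrite mem_filter.
  by case/andP=> /eqP y4 /ws; lia.
have [kF eF] : exists k, signed_sum gF sF = 4 * k.
  by apply: signed_sum_dvd => y; rewrite mem_filter => /andP[/eqP].
(* The first part is 0, 4 or -4, so the second one, bounded by 3, is 0, 2 or -2. Flipping [x]
   changes it by 2, 4 or 6 in absolute value. *)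
have par g : exists k, signed_sum gF sF + signed_sum g sR = k *+ 2.
  have [h eh] := glue gF g; have [k ek] := signed_sum_parity h s.
  by exists (k0 + k); rewrite -eh ek even; lia.
have xR : x \in sR by rewrite mem_filter xs andbT; lia.
have [kR eR] := par gR.
have uR : uniq sR by rewrite filter_uniq.
have := signed_sum_flip gR uR xR; set gx := fun y => _ => ex.
have [gx' ex'] : exists h, signed_sum h sR = - signed_sum gx sR.
  by eexists; apply: signed_sumN.
have [gR' eR'] : exists h, signed_sum h sR = - signed_sum gR sR.
  by eexists; apply: signed_sumN.
suff [g hg] : exists g, `|signed_sum gF sF + signed_sum g sR| <= 2.
  by have [h eh] := glue gF g; exists h; rewrite eh.
move: ex; set v := if gR x then _ else _ => ex.
have vx : v = w x \/ v = - w x by rewrite /v; case: ifP; auto.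
have [h|h] := lerP `|signed_sum gF sF + signed_sum gR sR| 2; first by exists gR.
have [h'|h'] := lerP `|signed_sum gF sF + signed_sum gR' sR| 2; first by exists gR'.
have [h1|h1] := lerP `|signed_sum gF sF + signed_sum gx sR| 2; first by exists gx.
exists gx'; rewrite ex'; move: h h' h1; rewrite eR' ex; lia.
Qed.

End Signs.

(** * Comparison of a rigid cover with an arbitrary one *)

Lemma fset_two (K : choiceType) (A : {fset K}) : (1 < #|` A|)%N ->
  exists x y, [/\ x \in A, y \in A & x != y].
Proof.
move=> A1; have /fset0Pn[x xA] : A != fset0 by rewrite -cardfs_gt0 ltnW.
have /fset0Pn[y] : (A `\ x)%fset != fset0.
  by rewrite -cardfs_gt0; move: A1; rewrite (cardfsD1 x) xA.
by rewrite in_fsetD1 => /andP[yx yA]; exists x, y; rewrite eq_sym.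
Qed.

Section StarCovers.
Variable R : realType.
Implicit Types (S : {fset plane R}) (H : star R) (alpha rho beta : {fset star R}).
Implicit Types (u v w x y b e p q : plane R) (eps : R).
Local Open Scope ring_scope.

Lemma distC u v : dist u v = dist v u.
Proof. by rewrite /dist -(sqrrN (u.1 - _)) -(sqrrN (u.2 - _)) !opprB. Qed.

Lemma adjC eps u v : adj eps u v = adj eps v u.
Proof. by rewrite /adj eq_sym distC. Qed.

Lemma adj_ne eps u v : adj eps u v -> u != v.
Proof. by case/andP. Qed.

Lemma in_star H p : (p \in star_vertices H) = (p == H.1) || (p \in H.2).
Proof. by rewrite /star_vertices in_fset1U. Qed.

Lemma star_inS S eps H p : is_star S eps H -> p \in star_vertices H -> p \in S.
Proof. by case=> /fsubsetP h _ _ /h. Qed.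

Lemma star_partner S eps H p : is_star S eps H -> p \in star_vertices H ->
  exists2 q, q \in star_vertices H & adj eps p q.
Proof.
case=> _ /fset0Pn[l hl] hadj; rewrite in_star => /orP[/eqP ->|pl].
  by exists l; [rewrite in_star hl orbT | exact: hadj].
by exists H.1; [rewrite in_star eqxx | rewrite adjC; exact: hadj].
Qed.

Lemma star_cover_eq S alpha H H' p : star_cover S alpha -> H \in alpha ->
  H' \in alpha -> p \in star_vertices H -> p \in star_vertices H' -> H = H'.
Proof.
case=> _ disj _ Ha Ha' pH pH'; apply/eqP/negPn/negP => /(disj _ _ Ha Ha') /fsetP.
by move/(_ p); rewrite in_fsetI pH pH' in_fset0.
Qed.

(* [rigid_edge]: dissolving the edge [x y] and attaching [x] to [b] and [y] to
   [e] would not create a star with two or three leaves. *)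
Record rigid S alpha : Prop := Rigid {
  rigid_cover : star_cover S alpha;
  rigid_size H : H \in alpha -> #|` H.2| = 1%N \/ #|` H.2| = 5%N;
  rigid_leaf H v w : H \in alpha -> #|` H.2| = 5%N -> v \in H.2 -> w \in S ->
    adj (eps_star S) v w -> w = H.1;
  rigid_center H w : H \in alpha -> #|` H.2| = 5%N -> w \in S ->
    adj (eps_star S) H.1 w -> w \in H.2;
  rigid_edge H H' x y b e : H \in alpha -> #|` H.2| = 1%N ->
    x \in star_vertices H -> y \in star_vertices H -> x != y ->
    adj (eps_star S) x b -> adj (eps_star S) y e -> b \in S -> e \in S ->
    b \notin star_vertices H -> e \notin star_vertices H ->
    H' \in alpha -> b \in star_vertices H' -> b != e /\ e \in star_vertices H'
}.

Section Rigid.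
Variables (S : {fset plane R}) (alpha alpha' : {fset star R}).
Hypothesis rig : rigid S alpha.
Hypothesis cov' : star_cover S alpha'.
Local Notation adjS := (adj (eps_star S)).

Let cov : star_cover S alpha := rigid_cover rig.

Lemma cover_star beta H : star_cover S beta -> H \in beta -> is_star S (eps_star S) H.
Proof. by case=> h _ _ /h. Qed.

Lemma cover_nbr beta p : star_cover S beta -> p \in S ->
  exists H q, [/\ H \in beta, p \in star_vertices H, q \in star_vertices H,
    q \in S & adjS p q].
Proof.
move=> cb pS; have [_ _ /(_ p pS)[H Hb pH]] := cb.
have st := cover_star cb Hb.
have [q qH pq] := star_partner st pH.
by exists H, q; split=> //; apply: star_inS st qH.
Qed.

(** The only neighbour of a leaf of [H] is [H.1], so [alpha'] has all these leaves in the star that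
    contains [H.1]. If that star had another center, this would be a leaf of [H] adjacent to another
    leaf of [H]. *)
Lemma rigid_five H : H \in alpha -> #|` H.2| = 5%N -> H \in alpha'.
Proof.
move=> Ha H5; have sH := cover_star cov Ha.
have cS : H.1 \in S by apply: (star_inS sH); rewrite in_star eqxx.
have [_ _ /(_ _ cS)[H' Ha' cH']] := cov'.
have sH' := cover_star cov' Ha'.
have sub v : v \in H.2 -> v \in star_vertices H'.
  move=> vH; have vS : v \in S by apply: (star_inS sH); rewrite in_star vH orbT.
  have [K [q [Ka vK qK qS vq]]] := cover_nbr cov' vS.
  have qc := rigid_leaf rig Ha H5 vH qS vq; rewrite qc in qK.
  by rewrite -(star_cover_eq cov' Ka Ha' qK cH').
have [_ _ adjH] := sH; have [_ _ adjH'] := sH'.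
have c'S : H'.1 \in S by apply: (star_inS sH'); rewrite in_star eqxx.
have cc : H'.1 = H.1.
  apply/eqP/negPn/negP => ne; have cH'2 : H.1 \in H'.2.
    by move: cH'; rewrite in_star eq_sym (negbTE ne).
  have c'H : H'.1 \in H.2 by apply: (rigid_center rig) => //; rewrite adjC; apply: adjH'.
  have [|v1 [v2 [v1H v2H v12]]] := @fset_two _ H.2; first by rewrite H5.
  have [v [vH vne]] : exists v, v \in H.2 /\ v != H'.1.
    by case: (eqVneq v1 H'.1) v12 => [->|]; [rewrite eq_sym; exists v2 | exists v1].
  have := sub v vH; rewrite in_star (negbTE vne) => /= vH'.
  have vS : v \in S by apply: (star_inS sH); rewrite in_star vH orbT.
  have vc := rigid_leaf rig Ha H5 c'H vS (adjH' v vH').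
  by have := adj_ne (adjH v vH); rewrite vc eqxx.
suff -> : H = H' by [].
rewrite [H]surjective_pairing [H']surjective_pairing cc; congr pair.
apply/fsetP => v; apply/idP/idP => vH.
  have := sub v vH; rewrite in_star cc => /orP[/eqP e|//].
  by have := adj_ne (adjH v vH); rewrite e eqxx.
apply: (rigid_center rig) => //; last by rewrite -cc; apply: adjH'.
by apply: (star_inS sH'); rewrite in_star vH orbT.
Qed.

Lemma single_edge H c : H \in alpha -> #|` H.2| = 1%N -> c \in star_vertices H ->
  exists y, [/\ y \in star_vertices H, c != y, adjS c y &
    forall z, z \in star_vertices H -> z = c \/ z = y].
Proof.
move=> Ha H1; have [_ _ adjH] := cover_star cov Ha.
have /cardfs1P[l el] : #|` H.2| == 1%N by rewrite H1.
have := adjH l; rewrite el in_fset1 eqxx => /(_ isT) hl.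
rewrite in_star el in_fset1 => /orP[]/eqP ->.
- exists l; split=> //; first by rewrite in_star el in_fset1 eqxx orbT.
    exact: adj_ne hl.
  by move=> z; rewrite in_star el in_fset1 => /orP[]/eqP ->; auto.
- exists H.1; rewrite adjC; split=> //; first by rewrite in_star eqxx.
    by rewrite eq_sym; exact: adj_ne hl.
  by move=> z; rewrite in_star el in_fset1 => /orP[]/eqP ->; auto.
Qed.

(* Every edge of [alpha] has an endpoint of degree one in the graph or lies on
   a component that is a cycle of length four. *)
Lemma rigid_big H' : H' \in alpha' -> (1 < #|` H'.2|)%N ->
  H' \in alpha /\ #|` H'.2| = 5%N.
Proof.
move=> Ha' /fset_two[l1 [l2 [l1H l2H l12]]].
have sH' := cover_star cov' Ha'; have [_ _ adjH'] := sH'.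
have cH' : H'.1 \in star_vertices H' by rewrite in_star eqxx.
have cS := star_inS sH' cH'.
have leafV z : z \in H'.2 -> z \in star_vertices H' by rewrite in_star => ->; rewrite orbT.
have [_ _ /(_ _ cS)[H Ha cH]] := cov.
have five K z : K \in alpha -> z \in star_vertices K -> z \in star_vertices H' ->
    #|` K.2| = 5%N -> K = H'.
  by move=> Ka zK zH' K5; apply: (star_cover_eq cov' _ Ha' zK zH'); apply: rigid_five.
case: (rigid_size rig Ha) => [H1|H5]; last by have <- := five H _ Ha cH cH' H5.
exfalso.
have [y [yH cy acy Hcy]] := single_edge Ha H1 cH.
have [l [lH ly]] : exists l, l \in H'.2 /\ l != y.
  by case: (eqVneq l1 y) l12 => [->|]; [rewrite eq_sym; exists l2 | exists l1].
have lH' := leafV l lH; have lS := star_inS sH' lH'; have acl := adjH' l lH.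
have out z : z \in H'.2 -> z != y -> z \notin star_vertices H.
  move=> zH zy; apply/negP => /Hcy[e|e]; last by rewrite e eqxx in zy.
  by have := adj_ne (adjH' z zH); rewrite e eqxx.
have lnH := out l lH ly.
have [_ _ /(_ _ lS)[H2 Ha2 lH2]] := cov.
have H12 : H2 != H by apply: contraNneq lnH => <-.
have H21 : #|` H2.2| = 1%N.
  case: (rigid_size rig Ha2) => // H25.
  have e := five H2 l Ha2 lH2 lH' H25.
  by rewrite (star_cover_eq cov Ha2 Ha _ cH) ?eqxx // e in H12.
have disj z : z \in star_vertices H -> z \in star_vertices H2 -> False.
  by move=> zH zH2; rewrite (star_cover_eq cov Ha2 Ha zH2 zH) eqxx in H12.
have [m [mH2 lm alm Hlm]] := single_edge Ha2 H21 lH2.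
have mS := star_inS (cover_star cov Ha2) mH2.
have yS := star_inS (cover_star cov Ha) yH.
have cnH2 : H'.1 \notin star_vertices H2 by apply/negP => /(disj _ cH).
have alc : adjS l H'.1 by rewrite adjC.
(* Rigidity of the edge [l m], with [l] attached to the center of [H']: the only outside neighbour
   left for [m] is the other end [y] of the edge of that center. *)
have mout e : e \in S -> adjS m e -> e \notin star_vertices H2 -> e = y.
  move=> eS ame enH2.
  have [ce eH] := rigid_edge rig Ha2 H21 lH2 mH2 lm alc ame cS eS cnH2 enH2 Ha cH.
  by case: (Hcy e eH) => // ec; rewrite ec eqxx in ce.
have [K [q [Ka mK qK qS amq]]] := cover_nbr cov' mS.
have mc : m != H'.1 by apply: contraNneq cnH2 => <-.
have [ql|ql] := eqVneq q l.
  rewrite ql in qK; rewrite (star_cover_eq cov' Ka Ha' qK lH') in mK.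
  have mH' : m \in H'.2 by move: mK; rewrite in_star (negbTE mc).
  have amc : adjS m H'.1 by rewrite adjC; apply: adjH'.
  by have e := mout _ cS amc cnH2; rewrite -e eqxx in cy.
have qnH2 : q \notin star_vertices H2.
  apply/negP => /Hlm[e|e]; first by rewrite e eqxx in ql.
  by have := adj_ne amq; rewrite e eqxx.
have qy := mout q qS amq qnH2; rewrite qy in qK amq.
have mnH : m \notin star_vertices H by apply/negP => /disj /(_ mH2).
(* Now [H'.1], [l], [m], [y] form a cycle. Rigidity of the edge [H'.1 y], with [y] attached to [m],
   forces the center to go to [l]. *)
have cout z : z \in H'.2 -> z = y \/ z = l.
  move=> zH; have [zy|zy] := eqVneq z y; first by left.
  right; have znH := out z zH zy.
  have zS := star_inS sH' (leafV z zH).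
  have aym : adjS y m by rewrite adjC.
  have yc : y != H'.1 by rewrite eq_sym.
  have [mz zH2] := rigid_edge rig Ha H1 yH cH yc aym (adjH' z zH) mS zS mnH znH Ha2 mH2.
  by case: (Hlm z zH2) => // e; rewrite e eqxx in mz.
have yH' : y \in H'.2.
  case: (cout l1 l1H) => [<-//|e1]; case: (cout l2 l2H) => [<-//|e2].
  by rewrite e1 e2 eqxx in l12.
(* The star of [m] in [alpha'] contains [y], so it is [H']; but the leaves of [H'] are [y] and
   [l]. *)
rewrite (star_cover_eq cov' Ka Ha' qK (leafV y yH')) in mK.
have mH' : m \in H'.2 by move: mK; rewrite in_star (negbTE mc).
case: (cout m mH') => e; last by rewrite e eqxx in lm.
by rewrite e yH in mnH.
Qed.

End Rigid.
End StarCovers.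

(** * Bounds on [Delta] *)

Section Deltas.
Variable R : realType.
Implicit Types (S : {fset plane R}) (H : star R) (alpha rho beta : {fset star R}).
Local Open Scope ring_scope.

Lemma card_star S eps H : is_star S eps H -> #|` star_vertices H| = #|` H.2|.+1.
Proof.
case=> _ _ adjH; rewrite /star_vertices cardfsU1.
by case: (boolP (H.1 \in H.2)) => // /adjH /adj_ne; rewrite eqxx.
Qed.

Lemma card_star_cover S alpha : star_cover S alpha ->
  #|` S| = (\sum_(H <- alpha) #|` H.2|.+1)%N.
Proof.
move=> cov; have [_ _ onto] := cov.
have one p : p \in S -> (\sum_(H <- alpha) (p \in star_vertices H) = 1)%N.
  move=> pS; have [H Ha pH] := onto p pS.
  rewrite (bigD1_seq H Ha (fset_uniq _)) /= pH big_seq_cond big1 // => H'.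
  case/andP=> Ha' ne; apply/eqP; rewrite eqb0; apply/negP => pH'.
  by rewrite (star_cover_eq cov Ha' Ha pH' pH) eqxx in ne.
rewrite card_fset_sum1 big_seq.
transitivity (\sum_(p <- S | p \in S) \sum_(H <- alpha) (p \in star_vertices H))%N.
  by apply: eq_bigr => p /one ->.
rewrite -big_seq exchange_big /=; apply: eq_big_seq => H Ha.
have sH := cover_star cov Ha.
rewrite -(card_star sH) -big_mkcond /= big_fset_condE /= -card_fset_sum1.
congr (#|` _|); apply/fsetP => p; rewrite !inE /=.
by apply: andb_idl; rewrite -in_star => /(star_inS sH).
Qed.

Lemma Delta_le_signed alpha (g : star R -> bool) :
  (Delta alpha <= `|signed_sum (@star_balance R) g alpha|)%N.
Proof.
have [_ h] := Delta_min alpha.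
have := h [fset H in alpha | g H]%fset [fset H in alpha | ~~ g H]%fset.
set rho := [fset H in alpha | g H]%fset; set beta := [fset H in alpha | ~~ g H]%fset.
have -> : Delta2 rho beta = `|signed_sum (@star_balance R) g alpha|%N.
  rewrite /Delta2 /balance /signed_sum -!big_fset_condE /=.
  rewrite (bigID g predT) /= -sumrN; congr absz; congr (_ + _).
    by apply: eq_bigr => H ->.
  by apply: eq_bigr => H /negbTE ->.
apply; apply/fsetP => H; rewrite !inE /=; case: (H \in alpha); case: (g H) => //.
Qed.

Lemma Delta_small S alpha : star_cover S alpha ->
  (forall H, H \in alpha -> (#|` H.2| <= 5)%N) -> (Delta alpha <= 4)%N.
Proof.
move=> cov s5.
have [||//|g hg] := @signs_le _ (@star_balance R) 4 alpha.
- exact: fset_uniq.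
- move=> H Ha; have := s5 H Ha; have [_ + _] := cover_star cov Ha.
  by rewrite -cardfs_gt0 /star_balance; lia.
by apply: leq_trans (Delta_le_signed alpha g) _; lia.
Qed.

Lemma Delta_mid S alpha : star_cover S alpha -> ~~ odd #|` S| ->
  (forall H, H \in alpha -> (#|` H.2| <= 5)%N) ->
  (exists2 H, H \in alpha & (1 < #|` H.2| < 5)%N) -> (Delta alpha <= 2)%N.
Proof.
move=> cov evS s5 [H0 Ha0 h0].
have even : exists k, \sum_(H <- alpha) star_balance H = k *+ 2.
  have := card_star_cover cov; have [k ->] : exists k, #|` S| = k.*2.
    by exists (#|` S|./2); rewrite even_halfK.
  (* A star has two more vertices than its balance. *)
  have -> : \sum_(H <- alpha) star_balance H =
      (\sum_(H <- alpha) #|` H.2|.+1)%N%:Z - (#|` alpha|)%:Z *+ 2.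
    elim: (enum_fset alpha) => [|H s IH]; first by rewrite !big_nil.
    by rewrite !big_cons IH /star_balance /=; lia.
  move=> <-; exists (k%:Z - (#|` alpha|)%:Z); lia.
have [||||//|g hg] := @signs_mid _ (@star_balance R) alpha H0.
- exact: fset_uniq.
- move=> H Ha; have := s5 H Ha; have [_ + _] := cover_star cov Ha.
  by rewrite -cardfs_gt0 /star_balance; lia.
- by [].
- by move: h0; rewrite /star_balance; move: #|` H0.2| => k /andP[]; lia.
by apply: leq_trans (Delta_le_signed alpha g) _; lia.
Qed.

Definition fives alpha := [fset H in alpha | #|` H.2| == 5%N]%fset.

Lemma balance_fives alpha :
  (forall H, H \in alpha -> #|` H.2| = 1%N \/ #|` H.2| = 5%N) ->
  balance alpha = (4 * #|` fives alpha|)%N.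
Proof.
rewrite card_fset_sum1 -big_fset_condE /= /balance => h.
have {h} : forall H, H \in enum_fset alpha -> #|` H.2| = 1%N \/ #|` H.2| = 5%N by [].
elim: (enum_fset alpha) => [|H s IH h]; first by rewrite !big_nil.
rewrite !big_cons IH => [|K Ks]; last by apply: h; rewrite inE Ks orbT.
by rewrite /star_balance; case: (h H (mem_head _ _)) => -> /=; lia.
Qed.

Lemma rigid_optimal S alpha : rigid S alpha ->
  (Delta alpha = 4%N /\
   forall alpha', star_cover S alpha' -> (Delta alpha <= Delta alpha')%N) \/
  (Delta alpha <= 2)%N.
Proof.
move=> rig; have cov := rigid_cover rig.
have le4 : (Delta alpha <= 4)%N.
  by apply: (Delta_small cov) => H /(rigid_size rig)[]->.
(* All covers share the stars with five leaves, and only these have a nonzero balance; [a] and [b]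
   count them in the two parts of an optimal partition. *)
have key alpha' : star_cover S alpha' ->
    exists a b, (a + b = #|` fives alpha|)%N /\
      Delta alpha' = `|((4 * a)%N%:Z - (4 * b)%N%:Z)%R|%N.
  move=> cov'.
  have sz H : H \in alpha' -> #|` H.2| = 1%N \/ #|` H.2| = 5%N.
    move=> Ha'; have [_ + _] := cover_star cov' Ha'; rewrite -cardfs_gt0 => gt0.
    case: (ltnP 1 #|` H.2|) => [/(rigid_big rig cov' Ha')[]|le1]; first by right.
    by left; lia.
  have [[rho [beta [eU eI <-]]] _] := Delta_min alpha'.
  have szr H : H \in rho -> #|` H.2| = 1%N \/ #|` H.2| = 5%N.
    by move=> hr; apply: sz; rewrite -eU in_fsetU hr.
  have szb H : H \in beta -> #|` H.2| = 1%N \/ #|` H.2| = 5%N.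
    by move=> hr; apply: sz; rewrite -eU in_fsetU hr orbT.
  exists #|` fives rho|, #|` fives beta|; split; last first.
    by rewrite /Delta2 !balance_fives.
  have -> : fives alpha = (fives rho `|` fives beta)%fset.
    apply/fsetP => H; have /fsetP/(_ H) := eU; rewrite !inE /= => eH.
    rewrite -andb_orl eH; apply/andP/andP => -[h1 /eqP h5]; split; rewrite ?h5 //.
      exact: (rigid_five rig).
    have := rigid_big rig cov' h1; rewrite h5 => /(_ isT)[].
    by [].
  rewrite cardfsU; have -> : (fives rho `&` fives beta = fset0)%fset.
    apply/fsetP => H; have /fsetP/(_ H) := eI; rewrite !inE /=.
    rewrite -[H \in [eta mem_seq rho]]/(H \in rho).
    rewrite -[H \in [eta mem_seq beta]]/(H \in beta).
    by case: (H \in rho); case: (H \in beta); rewrite ?andbF.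
  by rewrite cardfs0 subn0.
have [a [b [eab eD]]] := key alpha cov.
(* If [a + b] is odd, the multiple [4 * (a - b)] of 4 is not 0. If it is even, this is a multiple of
   8, and the bound 4 leaves only 0. *)
have [od|ev] := boolP (odd #|` fives alpha|); [left|right].
  have ge4 alpha' : star_cover S alpha' -> (4 <= Delta alpha')%N.
    by move=> /key[a' [b' [e' ->]]]; move: od; rewrite -e'; lia.
  have e4 : Delta alpha = 4%N by apply/eqP; rewrite eqn_leq le4 ge4.
  by split=> // alpha'; rewrite e4; apply: ge4.
by move: ev le4; rewrite eD -eab; lia.
Qed.

End Deltas.

(** * Covers of indexed points, and the effect of having no move left *)

Section Indices.
Variables (R : realType) (pts : seq (plane R)) (e : R).
Hypothesis upts : uniq pts.
Local Open Scope ring_scope.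
Local Notation n := (size pts).
Local Notation pt := (nth 0 pts).
Implicit Types (C D : nat -> nat).

Definition near i j : bool := (i != j) && (sqdist (pt i) (pt j) <= e).

Lemma near_sym i j : near i j -> near j i.
Proof. by rewrite /near eq_sym sqdistC. Qed.

Lemma near_irr i j : near i j -> i != j.
Proof. by case/andP. Qed.

Local Notation valid := (valid n near).
Local Notation covering := (covering n near).
Local Notation deg := (deg n).

Lemma pt_inj i j : (i < n)%N -> (j < n)%N -> (pt i == pt j) = (i == j).
Proof. by move=> iltn jn; rewrite nth_uniq. Qed.

Definition leaves C j := [seq i <- iota 0 n | (i != j) && (C i == j)].

Lemma mem_leaves C j i :
  (i \in leaves C j) = [&& (i < n)%N, i != j & C i == j].
Proof. by rewrite mem_filter mem_iota /= add0n andbC. Qed.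

Lemma leaves_map_uniq C j : uniq (map pt (leaves C j)).
Proof.
rewrite map_inj_in_uniq ?filter_uniq ?iota_uniq // => i i'.
rewrite !mem_leaves => /andP[il _] /andP[il' _] /eqP.
by rewrite pt_inj // => /eqP.
Qed.

Lemma split_small C D : covering C D ->
  (forall i j, (i < n)%N -> (j < n)%N -> near i j -> C i = C j -> C i != i ->
     C j != j -> (D (C i) <= 2)%N) ->
  small n D.
Proof.
move=> [V N] h c cn; rewrite leqNgt; apply/negP => Dc.
have cc := valid_center V cn (ltn_trans (isT : (0 < 5)%N) Dc).
have [_ _ _ dc] := V c cn.
apply: (@no_six_neighbours _ (pt c) e (map pt (leaves C c))).
- exact: leaves_map_uniq.
- by rewrite size_map size_filter -/(deg C c) -dc.
- move=> u /mapP[i]; rewrite mem_leaves => /and3P[il ic /eqP ci] ->.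
  have [_ _ + _] := V i il; rewrite ci eq_sym ic => /(_ isT) /near_sym.
  by case/andP.
- move=> u v /mapP[i + ->] /mapP[j + ->].
  rewrite !mem_leaves => /and3P[il ic /eqP ci] /and3P[jl jc /eqP cj].
  rewrite pt_inj // => ij; rewrite ltNge; apply/negP => d.
  have := h i j il jl; rewrite /near ij d ci cj (eq_sym c i) (eq_sym c j) ic jc.
  by move=> /(_ isT erefl isT isT); lia.
Qed.

Section NoMove.
Variables (C D : nat -> nat).
Hypothesis cov : covering C D.
Hypothesis size15 : forall k, (k < n)%N -> [\/ D k = 0%N, D k = 1%N | D k = 5%N].
Hypothesis no_move : forall i j, (i < n)%N -> (j < n)%N -> near i j ->
  C i != i -> D (C i) = 5%N -> j != C i -> C j = j /\ D j = 5%N.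

Let V : valid C D := cov.1.

(** The leaves of [c] are pairwise far apart, since a leaf adjacent to another one could be moved.
    If [z] were far from all of them, [c] would have six neighbours pairwise far apart. *)
Lemma sixth_neighbour c z : (c < n)%N -> (z < n)%N -> D c = 5%N ->
  near c z -> C z != c ->
  exists l, [/\ (l < n)%N, C l = c, l != c & near l z].
Proof.
move=> cn zn Dc cz zc; apply: contrapT => ne.
have cc := valid_center V cn (ltac:(by rewrite Dc) : (0 < D c)%N).
have [_ _ _ dc] := V cn.
have far i : (i < n)%N -> C i = c -> i != c -> e < sqdist (pt i) (pt z).
  move=> il ci ic; rewrite ltNge; apply/negP => d; apply: ne; exists i; split=> //.
  by rewrite /near d andbT; apply: contraNneq zc => <-; rewrite ci.
apply: (@no_six_neighbours _ (pt c) e (pt z :: map pt (leaves C c))).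
- rewrite /= leaves_map_uniq andbT; apply/mapP => -[i].
  rewrite mem_leaves => /and3P[il ic /eqP ci] /eqP; rewrite pt_inj // => /eqP zi.
  by rewrite zi ci eqxx in zc.
- by rewrite /= size_map size_filter -/(deg C c) -dc Dc.
- move=> u; rewrite inE => /orP[/eqP ->|]; first by case/andP: cz.
  move=> /mapP[i]; rewrite mem_leaves => /and3P[il ic /eqP ci] ->.
  have [_ _ + _] := V il; rewrite ci eq_sym ic => /(_ isT) /near_sym.
  by case/andP.
- move=> u v; rewrite !inE => /orP[/eqP ->|+] /orP[/eqP ->|+].
  + by rewrite eqxx.
  + move=> /mapP[i]; rewrite mem_leaves => /and3P[il ic /eqP ci] -> _.
    by rewrite sqdistC; exact: far.
  + move=> /mapP[i]; rewrite mem_leaves => /and3P[il ic /eqP ci] -> _.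
    exact: far.
  move=> /mapP[i + ->] /mapP[j + ->].
  rewrite !mem_leaves => /and3P[il ic /eqP ci] /and3P[jl jc /eqP cj].
  rewrite pt_inj // => ij; rewrite ltNge; apply/negP => d.
  have nij : near i j by rewrite /near ij d.
  have := no_move il jl nij; rewrite ci eq_sym ic => /(_ isT Dc jc)[e1 _].
  by rewrite -cj e1 eqxx in jc.
Qed.

(** By [no_move], another neighbour [j] would be the center of a full star; but then [i] would be
    close to a leaf of that star and could be moved there. *)
Lemma leaf5_nbr i j : (i < n)%N -> (j < n)%N -> C i != i -> D (C i) = 5%N ->
  near i j -> j = C i.
Proof.
move=> il jl ci di nij; apply/eqP/negPn/negP => jc.
have [cj dj] := no_move il jl nij ci di jc.
have [_ cci _ _] := V il.
have cij : C i != j by rewrite eq_sym.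
have [l [ln cl lj nli]] := sixth_neighbour jl il dj (near_sym nij) cij.
have lc : l != C i by apply: contraNneq cij => h; rewrite -cl h cci.
have [cll _] := no_move il ln (near_sym nli) ci di lc.
by rewrite -cll cl eqxx in lj.
Qed.

Lemma center5_nbr c z : (c < n)%N -> (z < n)%N -> D c = 5%N -> near c z -> C z = c.
Proof.
move=> cn zn dc ncz; apply/eqP/negPn/negP => cz.
have [l [ln cl lc nlz]] := sixth_neighbour cn zn dc ncz cz.
have := leaf5_nbr ln zn; rewrite cl eq_sym lc dc => /(_ isT erefl nlz) zc.
by have := near_irr ncz; rewrite zc eqxx.
Qed.

Lemma center_size z : (z < n)%N -> D (C z) = 1%N \/ D (C z) = 5%N.
Proof.
move=> zn; have [cn cc _ _] := V zn; have := cov.2 _ cn cc.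
by case: (size15 cn) => ->; auto.
Qed.

Lemma edge_nbr x z : (x < n)%N -> (z < n)%N -> D (C x) = 1%N -> near x z ->
  D (C z) = 1%N.
Proof.
move=> xn zn dx nxz; have [//|dz] := center_size zn.
have [_ cc _ _] := V zn.
have [cz|cz] := eqVneq (C z) z.
  rewrite cz in dz; have := center5_nbr zn xn dz (near_sym nxz) => cx.
  by rewrite cx dz in dx.
have xc := leaf5_nbr zn xn cz dz (near_sym nxz).
by rewrite xc cc dz in dx.
Qed.

End NoMove.

(** * The output as a star cover, and the value of the threshold *)

Section Output.
Variable S : {fset plane R}.
Hypothesis ptsS : pts =i S.

Lemma in_pts p : p \in S -> exists2 i, (i < n)%N & p = pt i.
Proof.
by rewrite -ptsS => pS; exists (index p pts); rewrite ?index_mem ?nth_index.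
Qed.

Lemma pt_inS i : (i < n)%N -> pt i \in S.
Proof. by move=> il; rewrite -ptsS mem_nth. Qed.

Lemma card_pts : #|` S| = n.
Proof.
by apply/perm_size/uniq_perm; [exact: fset_uniq | | move=> p; rewrite ptsS].
Qed.

Definition star_at C j : star R :=
  (pt j, [fset pt i | i in iota 0 n & (i != j) && (C i == j)]%fset).

Lemma stars_ofP C H :
  reflect (exists j, [/\ (j < n)%N, C j = j & H = star_at C j])
          (H \in stars_of pts C).
Proof.
apply: (iffP (imfsetP _ _ _ _)) => /= [[j]|[j [jl cj ->]]].
  by rewrite inE mem_iota /= add0n => /andP[jl /eqP cj] ->; exists j.
by exists j; rewrite // inE mem_iota /= add0n jl cj eqxx.
Qed.

Lemma in_star_leaves C j p :
  reflect (exists i, [/\ (i < n)%N, i != j, C i = j & p = pt i])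
          (p \in (star_at C j).2).
Proof.
apply: (iffP (imfsetP _ _ _ _)) => /= [[i]|[i [il ij ci ->]]].
  by rewrite inE mem_iota /= add0n => /and3P[il ij /eqP ci] ->; exists i.
by exists i; rewrite // inE mem_iota /= add0n il ij ci eqxx.
Qed.

Lemma in_star_at C j p : (j < n)%N -> C j = j ->
  reflect (exists i, [/\ (i < n)%N, C i = j & p = pt i])
          (p \in star_vertices (star_at C j)).
Proof.
move=> jl cj; rewrite in_star; apply: (iffP orP) => [[/eqP ->|]|[i [il ci ->]]].
- by exists j.
- by move=> /in_star_leaves[i [il _ ci ->]]; exists i.
- have [->|ij] := eqVneq i j; first by left.
  by right; apply/in_star_leaves; exists i.
Qed.

Lemma pt_in_star C j i : (j < n)%N -> C j = j -> (i < n)%N ->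
  (pt i \in star_vertices (star_at C j)) = (C i == j).
Proof.
move=> jl cj il; apply/in_star_at/eqP => // [[i' [il' ci /eqP]]|ci].
  by rewrite pt_inj // => /eqP ->.
by exists i.
Qed.

Lemma card_star_leaves C D j : valid C D -> (j < n)%N ->
  #|` (star_at C j).2| = D j.
Proof.
move=> V jl; have [_ _ _ ->] := V j jl.
rewrite /deg -size_filter -/(leaves C j) -(size_map pt).
apply/perm_size/uniq_perm; [exact: fset_uniq | exact: leaves_map_uniq |].
move=> p; apply/in_star_leaves/mapP => [[i [il ij ci ->]]|[i]].
  by exists i; rewrite // mem_leaves il ij ci eqxx.
by rewrite mem_leaves => /and3P[il ij /eqP ci] ->; exists i.
Qed.

Hypothesis e0 : 0 <= e.
Hypothesis tight : exists2 i, (i < n)%N &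
  forall j, (j < n)%N -> j != i -> e <= sqdist (pt i) (pt j).

Lemma dist_sqdist (u v : plane R) : dist u v = Num.sqrt (sqdist u v).
Proof. by rewrite /dist /sqdist !expr2. Qed.

Lemma bigmax_le (I : eqType) (r : seq I) (F : I -> R) (m : R) : 0 <= m ->
  (forall i, i \in r -> F i <= m) -> \big[Num.max/0]_(i <- r) F i <= m.
Proof.
move=> m0 h; rewrite big_seq; elim/big_ind: _ => // x y hx hy.
by rewrite ge_max hx hy.
Qed.

Lemma le_bigmax (I : eqType) (r : seq I) (F : I -> R) i : i \in r ->
  F i <= \big[Num.max/0]_(i <- r) F i.
Proof.
elim: r => // j r IH; rewrite inE big_cons le_max => /orP[/eqP ->|/IH ->].
  by rewrite lexx.
by rewrite orbT.
Qed.

Lemma walk_cost_ge (w : seq (seq (plane R) * seq (plane R))) b p q :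
  b \in w -> p \in b.1 -> q \in b.2 -> dist p q <= walk_cost w.
Proof.
move=> bw pb qb; apply: le_trans (le_bigmax _ bw).
by apply: le_trans (le_bigmax _ pb); apply: (le_bigmax (dist p)).
Qed.

(** The point of [tight] lies on one of the curves, and its block in a walk contains a point of the
    other curve. *)
Lemma le_dFrechet A B : partition_into_curves S A B -> Num.sqrt e <= dFrechet A B.
Proof.
case=> A0 B0 [X [Y [XY dXY AX BY _]]].
have [[w [fA fB ne _] <-] _] := dFrechet_min A0 B0.
have [i il far] := tight.
have apart p q : p \in A -> q \in B -> p != q.
  rewrite AX BY => pX qY; apply/eqP => pq; rewrite -pq in qY.
  by have := in_fset0 p; rewrite -dXY in_fsetI pX qY.
have inA b p : b \in w -> p \in b.1 -> p \in A.
  by move=> bw pb; rewrite -fA; apply/flattenP; exists b.1 => //; apply: map_f.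
have inB b p : b \in w -> p \in b.2 -> p \in B.
  by move=> bw pb; rewrite -fB; apply/flattenP; exists b.2 => //; apply: map_f.
have farS q : q \in S -> q != pt i -> Num.sqrt e <= dist (pt i) q.
  move=> /in_pts[j jl ->]; rewrite pt_inj // => ji.
  by rewrite dist_sqdist ler_wsqrtr // far.
have inS p : p \in A \/ p \in B -> p \in S.
  by rewrite -XY in_fsetU AX BY => -[->|->]; rewrite ?orbT.
have := pt_inS il; rewrite -XY in_fsetU -AX -BY => /orP[iA|iB].
- move: (iA); rewrite -fA => /flattenP[_ /mapP[b bw ->] ib].
  have [_] := ne b bw; case Eb: b.2 => [//|q l] _.
  have qb : q \in b.2 by rewrite Eb inE eqxx.
  have qB := inB b q bw qb.
  apply: le_trans (walk_cost_ge bw ib qb); apply: farS; first by apply: inS; right.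
  by rewrite eq_sym; apply: apart.
- move: (iB); rewrite -fB => /flattenP[_ /mapP[b bw ->] ib].
  have [+ _] := ne b bw; case Eb: b.1 => [//|q l] _.
  have qb : q \in b.1 by rewrite Eb inE eqxx.
  have qA := inA b q bw qb.
  apply: le_trans (walk_cost_ge bw qb ib); rewrite distC.
  by apply: farS; [apply: inS; left | apply: apart].
Qed.

(** One curve visits the centers, the other one the leaves star by star; each block of the walk is a
    center with its leaves. *)
Lemma cover_curves C D : covering C D -> (0 < n)%N ->
  exists A B, partition_into_curves S A B /\ dFrechet A B <= Num.sqrt e.
Proof.
move=> [V N] n0.
pose cs := [seq j <- iota 0 n | C j == j].
pose w := [seq ([:: pt j], map pt (leaves C j)) | j <- cs].
pose A := flatten [seq b.1 | b <- w]; pose B := flatten [seq b.2 | b <- w].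
have mem_cs j : (j \in cs) = (C j == j) && (j < n)%N by rewrite mem_filter mem_iota.
have EA : A = map pt cs.
  by rewrite /A /w -map_comp; elim: (cs) => //= j l ->.
have EB : B = [seq pt i | j <- cs, i <- leaves C j].
  by rewrite /B /w -map_comp.
have memA i : (i < n)%N -> (pt i \in A) = (C i == i).
  move=> il; rewrite EA; apply/mapP/idP => [[j]|ci].
    by rewrite mem_cs => /andP[cj jl] /eqP; rewrite pt_inj // => /eqP ->.
  by exists i; rewrite // mem_cs ci il.
have memB i : (i < n)%N -> (pt i \in B) = (C i != i).
  move=> il; have [cn cc _ _] := V i il.
  rewrite EB; apply/allpairsPdep/idP => [[j [i' [_ + /eqP]]]|ci].
    rewrite mem_leaves => /and3P[il' ij /eqP cj]; rewrite pt_inj // => /eqP ->.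
    by rewrite cj eq_sym.
  exists (C i), i; rewrite mem_cs cc eqxx cn mem_leaves il eqxx.
  by rewrite eq_sym ci.
have subA p : p \in A -> exists2 i, (i < n)%N & p = pt i.
  rewrite EA => /mapP[j]; rewrite mem_cs => /andP[_ jl] ->; by exists j.
have subB p : p \in B -> exists2 i, (i < n)%N & p = pt i.
  rewrite EB => /allpairsPdep[j [i' [_ + ->]]].
  by rewrite mem_leaves => /andP[il _]; exists i'.
have Cn : (C 0 < n)%N /\ C (C 0%N) = C 0%N by have [] := V 0%N n0.
have A0 : A != [::].
  apply/eqP => A0; have := memA _ Cn.1; by rewrite A0 Cn.2 eqxx.
have B0 : B != [::].
  have [j [jl jne cj]] := leaf_exists V Cn.1 (N _ Cn.1 Cn.2).
  by apply/eqP => B0; have := memB _ jl; rewrite B0 cj eq_sym jne.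
exists A, B; split.
  split=> //; exists [fset p in A]%fset, [fset p in B]%fset; split.
  - apply/fsetP => p; rewrite !inE; apply/orP/idP => [[|]|/in_pts[i il ->]].
    + by move=> /subA[i il ->]; apply: pt_inS.
    + by move=> /subB[i il ->]; apply: pt_inS.
    + by rewrite memA // memB //; case: eqP; auto.
  - apply/fsetP => p; rewrite !inE; apply/negP => /andP[pA].
    have [i il ip] := subA p pA; move: pA; rewrite ip memA // memB //.
    by move=> ->.
  - by move=> p; rewrite inE.
  - by move=> p; rewrite inE.
  - split.
      rewrite EA map_inj_in_uniq ?filter_uniq ?iota_uniq // => i j.
      rewrite !mem_cs => /andP[_ il] /andP[_ jl] /eqP.
      by rewrite pt_inj // => /eqP.
    rewrite EB; apply: allpairs_uniq_dep.
    - by rewrite filter_uniq ?iota_uniq.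
    - by move=> j _; rewrite filter_uniq ?iota_uniq.
    - move=> _ _ /allpairsPdep[j [i [_ + ->]]] /allpairsPdep[j' [i' [_ + ->]]] /=.
      rewrite !mem_leaves => /and3P[il _ /eqP <-] /and3P[il' _ /eqP <-] /eqP.
      by rewrite pt_inj // => /eqP ->.
have [_ h] := dFrechet_min A0 B0.
apply: le_trans (h w _) _; first split=> //.
- move=> b /mapP[j]; rewrite mem_cs => /andP[/eqP cj jl] -> /=; split=> //.
  have [i [il ij ci]] := leaf_exists V jl (N j jl cj).
  rewrite -size_eq0 size_map size_eq0; apply/eqP => E.
  by have := mem_leaves C j i; rewrite E il ij ci eqxx.
- by move=> b /mapP[j _ ->]; left.
apply: bigmax_le; first exact: sqrtr_ge0.
move=> b /mapP[j]; rewrite mem_cs => /andP[/eqP cj jl] -> /=.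
apply: bigmax_le; first exact: sqrtr_ge0.
move=> p; rewrite inE => /eqP ->.
apply: bigmax_le; first exact: sqrtr_ge0.
move=> q /mapP[i]; rewrite mem_leaves => /and3P[il ij /eqP ci] ->.
have [_ _ + _] := V i il; rewrite ci eq_sym ij => /(_ isT) /near_sym /andP[_ d].
by rewrite dist_sqdist ler_wsqrtr.
Qed.

Lemma eps_starE C D : covering C D -> (1 < n)%N -> eps_star S = Num.sqrt e.
Proof.
move=> cov n1; have S1 : (1 < #|` S|)%N by rewrite card_pts.
have [[A [B [hAB <-]]] hmin] := eps_star_min S1.
apply/eqP; rewrite eq_le le_dFrechet // andbT.
have [A' [B' [h' le']]] := cover_curves cov (ltnW n1).
exact: le_trans (hmin _ _ h') le'.
Qed.

Section StarsOf.
Variables C D : nat -> nat.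
Hypothesis cov : covering C D.
Hypothesis n1 : (1 < n)%N.
Local Notation alpha := (stars_of pts C).

Let V : valid C D := cov.1.

Lemma adj_pt i j : (i < n)%N -> (j < n)%N ->
  adj (eps_star S) (pt i) (pt j) = near i j.
Proof.
move=> il jl; rewrite /adj /near pt_inj // (eps_starE cov n1) dist_sqdist.
by rewrite ler_sqrt.
Qed.

Lemma stars_of_cover : star_cover S alpha.
Proof.
split.
- move=> _ /stars_ofP[j [jl cj ->]]; split.
  + apply/fsubsetP => p /in_star_at[//|//|i [il _ ->]]; exact: pt_inS.
  + rewrite -cardfs_gt0 (card_star_leaves V) //; exact: cov.2.
  + move=> p /in_star_leaves[i [il ij ci ->]]; rewrite adj_pt //.
    by have [_ _ + _] := V il; rewrite ci eq_sym ij => /(_ isT) /near_sym.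
- move=> _ _ /stars_ofP[j [jl cj ->]] /stars_ofP[j' [jl' cj' ->]] jj'.
  apply/fsetP => p; rewrite in_fsetI in_fset0; apply/negP => /andP[].
  move=> /in_star_at[//|//|i [il ci ->]]; rewrite pt_in_star // ci => /eqP e1.
  by rewrite e1 eqxx in jj'.
- move=> p /in_pts[i il ->]; have [cn cc _ _] := V il.
  exists (star_at C (C i)); first by apply/stars_ofP; exists (C i).
  by rewrite pt_in_star.
Qed.

Lemma stars_of_small : small n D -> forall H, H \in alpha -> (#|` H.2| <= 5)%N.
Proof.
by move=> sD _ /stars_ofP[j [jl cj ->]]; rewrite (card_star_leaves V) // sD.
Qed.

Lemma stars_of_mid : ~~ odd n -> small n D -> midstar n D -> (Delta alpha <= 2)%N.
Proof.
move=> ev sD [k kn dk]; apply: (Delta_mid stars_of_cover).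
- by rewrite card_pts.
- exact: stars_of_small.
exists (star_at C k); last by rewrite (card_star_leaves V).
apply/stars_ofP; exists k; split=> //; apply: (valid_center V kn).
by case/andP: dk => /ltnW.
Qed.

Lemma stars_of_rigid :
  small n D -> ~ midstar n D ->
  (forall i j, (i < n)%N -> (j < n)%N -> near i j ->
    C i != i -> D (C i) = 5%N -> j != C i -> C j = j /\ D j = 5%N) ->
  (forall x y b f, (x < n)%N -> (y < n)%N -> (b < n)%N -> (f < n)%N ->
    near x b -> near y f -> y != x -> C y = C x -> D (C x) = 1%N ->
    C b != C x -> D (C b) = 1%N -> C f != C x -> D (C f) = 1%N ->
    b != f /\ C b = C f) ->
  rigid S alpha.
Proof.
move=> sD nmid no_move no_rewire.
have size15 k : (k < n)%N -> [\/ D k = 0%N, D k = 1%N | D k = 5%N].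
  move=> kn; have := sD k kn; rewrite leq_eqVlt => /orP[/eqP|d5]; first by constructor 3.
  have : (D k <= 1)%N by rewrite leqNgt; apply/negP => d1; apply: nmid; exists k; rewrite ?d1.
  by case: (D k) => [|[|//]] _; [constructor 1 | constructor 2].
split.
- exact: stars_of_cover.
- move=> _ /stars_ofP[j [jl cj ->]]; rewrite (card_star_leaves V) //.
  by have := center_size cov size15 jl; rewrite cj.
- move=> _ v w /stars_ofP[j [jl cj ->]]; rewrite (card_star_leaves V) // => dj.
  move=> /in_star_leaves[i [il ij ci ->]] /in_pts[k kn ->]; rewrite adj_pt // => nik /=.
  have := leaf5_nbr cov no_move il kn; rewrite ci eq_sym ij dj.
  by move=> /(_ isT erefl nik) ->.
- move=> _ w /stars_ofP[j [jl cj ->]]; rewrite (card_star_leaves V) // => dj.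
  move=> /in_pts[k kn ->] /=; rewrite adj_pt // => njk.
  apply/in_star_leaves; exists k; split=> //.
    by rewrite eq_sym; apply: near_irr njk.
  exact: (center5_nbr cov no_move jl kn dj njk).
- move=> _ K x y b f /stars_ofP[j [jl cj ->]].
  rewrite (card_star_leaves V) // => dj.
  move=> /in_star_at[//|//|xi [xl cx ->]] /in_star_at[//|//|yi [yl cy ->]].
  rewrite pt_inj // => xy + + /in_pts[bi bl eb] /in_pts[fi fl ef].
  rewrite {}eb {}ef !adj_pt // !pt_in_star // => nxb nyf cb cf.
  move=> /stars_ofP[k [kl ck ->]]; rewrite !pt_in_star // pt_inj // => /eqP cbk.
  have dx : D (C xi) = 1%N by rewrite cx.
  have dy : D (C yi) = 1%N by rewrite cy.
  (* The field [rigid_edge] does not say that the new partners lie on edges; they do, because stars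
     with five leaves are components. *)
  have db := edge_nbr cov size15 no_move xl bl dx nxb.
  have df := edge_nbr cov size15 no_move yl fl dy nyf.
  have := no_rewire xi yi bi fi xl yl bl fl nxb nyf.
  rewrite eq_sym xy cx cy cb cf db df dj => /(_ isT erefl erefl isT erefl isT erefl)[bf e1].
  by rewrite bf -e1 cbk.
Qed.

End StarsOf.

End Output.
End Indices.

(** * One candidate per point suffices for the exchanges of edges *)

Lemma edge_three n A (C D : nat -> nat) a b c : valid n A C D ->
  (a < n)%N -> (b < n)%N -> (c < n)%N -> C b = C a -> C c = C a ->
  D (C a) = 1%N -> b != a -> c != a -> b = c.
Proof.
move=> V an bn cn cb cc d1 ba ca.
have dc : D (C c) = 1%N by rewrite cc.
have uniq_leaf u v : (u < n)%N -> (v < n)%N -> C u = C a -> C v = C a ->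
    C u != u -> C v != v -> u = v.
  move=> un vn cu cv hu hv; apply: (leaf_unique V un vn hu hv); rewrite cu //.
have [hb|hb] := eqVneq (C b) b; have [hc|hc] := eqVneq (C c) c.
- by rewrite -hb -hc cb cc.
- have ha : C a != a by rewrite -cb hb.
  by move: ca; rewrite (uniq_leaf c a) ?eqxx.
- have ha : C a != a by rewrite -cc hc.
  by move: ba; rewrite (uniq_leaf b a) ?eqxx.
- exact: uniq_leaf.
Qed.

(* [M x] is the partner of [x] and [F x] a neighbour of [x] outside its edge; it
   is enough to try the exchanges that move [y] to [F y]. *)
Lemma rewire_search n A (C D M F : nat -> nat) : valid n A C D ->
  (forall i, (M i < n)%N /\ (F i < n)%N) ->
  (forall i j, (i < n)%N -> (j < n)%N -> i != j -> C i = C j -> D (C i) = 1%N ->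
     M i = j) ->
  (forall i j, (i < n)%N -> (j < n)%N -> A i j -> C i != C j -> D (C j) = 1%N ->
     [/\ A i (F i), C i != C (F i) & D (C (F i)) = 1%N]) ->
  (forall x b, (x < n)%N -> (b < n)%N -> A x b -> A (M x) (F (M x)) ->
     M x != x -> C (M x) = C x -> D (C x) = 1%N -> C b != C x ->
     D (C b) = 1%N -> C (F (M x)) != C (M x) -> D (C (F (M x))) = 1%N ->
     b != F (M x) /\ C b = C (F (M x))) ->
  forall x y b f, (x < n)%N -> (y < n)%N -> (b < n)%N -> (f < n)%N ->
    A x b -> A y f -> y != x -> C y = C x -> D (C x) = 1%N ->
    C b != C x -> D (C b) = 1%N -> C f != C x -> D (C f) = 1%N ->
    b != f /\ C b = C f.
Proof.
move=> V MF HM HF none x y b f xn yn bn fn Axb Ayf yx cyx dx cb db cf df.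
have Mx : M x = y by apply: HM; rewrite // eq_sym.
have My : M y = x by apply: HM; rewrite // cyx.
have [Ay cy dy] : [/\ A y (F y), C y != C (F y) & D (C (F y)) = 1%N].
  by apply: HF Ayf _ df; rewrite // cyx eq_sym.
have [Ax cx dFx] : [/\ A x (F x), C x != C (F x) & D (C (F x)) = 1%N].
  by apply: HF Axb _ db; rewrite // eq_sym.
have Fxn := (MF x).2; have Fyn := (MF y).2.
(* Every possible target of [x] is the other end of the edge of [F y]. As [F x] is such a target, it
   is the only one. *)
have Wx c : (c < n)%N -> A x c -> C c != C x -> D (C c) = 1%N ->
    c != F y /\ C c = C (F y).
  move=> cn Axc cc dc; have := none x c xn cn Axc; rewrite Mx.
  by apply=> //; rewrite eq_sym.
have [b1 b2] := Wx b bn Axb cb db.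
have [x1 x2] : F x != F y /\ C (F x) = C (F y) by apply: Wx; rewrite // eq_sym.
have [f1 f2] : f != F x /\ C f = C (F x).
  have := none y f yn fn Ayf; rewrite My cyx; apply=> //; by rewrite eq_sym.
have -> : b = F x by apply: (edge_three V Fyn bn Fxn b2 x2).
by rewrite eq_sym f2.
Qed.

(** * The commands of the program and their denotations *)

Section Program.
Variable R : realType.
Implicit Types (s : state R) (u v : nexp).
Local Open Scope ring_scope.

(* Layout of the memory. Naturals: 0 number of points, 1 star centers, 2 numbers
   of leaves, 3 and 4 loop indices, 5 flag raised once some star has two, three
   or four leaves, 6 whether the minimum below is defined, 7 partners, 8
   neighbours outside the edge, 9 to 11 arguments of the commands below. Reals: 0
   and 1 coordinates, 2 square of eps*, 3 squared distances to the nearest point. *)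
Definition eqN u v := BAnd (BNatLe u v) (BNatLe v u).
Definition all_exp := foldr BAnd (BNatLe (NConst 0) (NConst 0)).
Definition sqdist_exp u v :=
  RAdd (RMul (RSub (RGet 0 u) (RGet 0 v)) (RSub (RGet 0 u) (RGet 0 v)))
       (RMul (RSub (RGet 1 u) (RGet 1 v)) (RSub (RGet 1 u) (RGet 1 v))).
Definition near_exp u v :=
  BAnd (BNot (eqN u v)) (BRealLe (sqdist_exp u v) (RGet 2 (NConst 0))).

Notation vi := (var 3).
Notation vj := (var 4).
Notation vt := (var 9).
Notation vp := (var 10).
Notation vq := (var 11).
Notation Cof := (NGet 1).
Notation Dof := (NGet 2).
Notation flag := (var 5).
Notation raise_flag := (NSet 5 (NConst 0) (NConst 1)).

(** The argument is copied first, as it may read cells that change; the count is updated before the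
    pointer that locates it. *)
Definition detach_cmd u :=
  Seq (NSet 11 (NConst 0) u)
    (If (eqN (Cof vq) vq) Skip
      (Seq (NSet 2 (Cof vq) (NSub (Dof (Cof vq)) (NConst 1))) (NSet 1 vq vq))).

Definition link_cmd u v :=
  Seq (NSet 1 u v) (NSet 2 v (NAdd (Dof v) (NConst 1))).

Definition free_leaf_cmd :=
  If (eqN vt vq) Skip
    (Seq (detach_cmd vq) (If (eqN (Dof vt) (NConst 0)) (link_cmd vt vq) Skip)).

(** Cell 9 keeps the old center of [v], needed after the pointer has been overwritten. *)
Definition attach_cmd u v :=
  Seq (NSet 10 (NConst 0) u) (Seq (NSet 11 (NConst 0) v)
    (Seq (NSet 9 (NConst 0) (Cof vq)) (Seq free_leaf_cmd (link_cmd vp vq)))).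

Definition centers s := (nmem s 1, nmem s 2).

Lemma beval_eqN s u v : beval s (eqN u v) = (neval s u == neval s v).
Proof. by rewrite /= eqn_leq. Qed.

Lemma beval_all_nil s : beval s (all_exp [::]) = true.
Proof. by []. Qed.

Lemma beval_all_cons s b l :
  beval s (all_exp (b :: l)) = beval s b && beval s (all_exp l).
Proof. by []. Qed.

Lemma beval_not s a : beval s (BNot a) = ~~ beval s a.
Proof. by []. Qed.

Lemma den_detach u s : centers (den (detach_cmd u) s) = detach (centers s) (neval s u).
Proof.
rewrite /detach_cmd /den -/den beval_eqN /= /upd /= /detach /=.
by case: ifP.
Qed.

Lemma den_seq c1 c2 s : den (Seq c1 c2) s = den c2 (den c1 s).
Proof. by []. Qed.

Lemma den_if a c1 c2 s : den (If a c1 c2) s = if beval s a then den c1 s else den c2 s.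
Proof. by []. Qed.

Lemma den_free_leaf s : nmem s 9 0 = nmem s 1 (nmem s 11 0) ->
  centers (den free_leaf_cmd s) = free_leaf (centers s) (nmem s 11 0) /\
  nmem (den free_leaf_cmd s) 11 0 = nmem s 11 0.
Proof.
move=> ht; rewrite /free_leaf_cmd den_if beval_eqN -[neval s vt]/(nmem s 9 0).
rewrite -[neval s vq]/(nmem s 11 0) ht /free_leaf -[(centers s).1]/(nmem s 1).
case: ifP => // _; rewrite den_seq den_if beval_eqN.
have := den_detach vq s; rewrite -[neval s vq]/(nmem s 11 0).
have q' : nmem (den (detach_cmd vq) s) 11 0 = nmem s 11 0.
  by rewrite /detach_cmd den_seq den_frame.
have t' : nmem (den (detach_cmd vq) s) 9 0 = nmem s 9 0 by rewrite den_frame.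
move: (den (detach_cmd vq) s) q' t' => s' q' t' <-.
rewrite /= t' ht; case: ifP => //= _.
by rewrite /centers /upd /= q'.
Qed.

(** The premise reflects that [v] is evaluated after cell 10 has been written. *)
Lemma den_attach u v s :
  neval (nupd s 10 0 (neval s u)) v = neval s v ->
  centers (den (attach_cmd u v) s) = attach (centers s) (neval s u) (neval s v).
Proof.
move=> hv; rewrite /attach_cmd !den_seq.
set s3 := den (NSet 9 _ _) _.
have q3 : nmem s3 11 0 = neval s v by rewrite /s3 /= hv.
have [|e1 e2] := den_free_leaf (s := s3); first by rewrite /s3 /= /upd.
have p4 : nmem (den free_leaf_cmd s3) 10 0 = neval s u by rewrite den_frame.
rewrite /attach -q3 -[centers s]/(centers s3) -e1.
move: (den free_leaf_cmd s3) e2 p4 => s4 e2 p4.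
by rewrite /centers /= /upd /= e2 p4.
Qed.

Definition reach c (n : nat) s (T : nat) (Q : state R -> Prop) :=
  exists t s', [/\ exec c s t s', (t <= T)%N, nmem s' 0 0 = n & Q s'].

Lemma reach_seq c1 c2 n s T1 T2 (Q1 Q2 : state R -> Prop) :
  reach c1 n s T1 Q1 ->
  (forall s', nmem s' 0 0 = n -> Q1 s' -> reach c2 n s' T2 Q2) ->
  reach (Seq c1 c2) n s (T1 + T2) Q2.
Proof.
move=> [t1 [s1 [e1 l1 n1 q1]]] /(_ s1 n1 q1)[t2 [s2 [e2 l2 n2 q2]]].
by exists (t1 + t2)%N, s2; split=> //; [apply: ExecSeq e1 e2 | lia].
Qed.

(** Array 6 stands in for an infinite initial minimum. The same loop makes every point its own
    center. *)
Definition min_cmd :=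
  Seq (NSet 1 vi vi)
    (If (eqN vi vj) Skip
      (If (all_exp [:: BNatLe (NConst 1) (NGet 6 vi); BRealLe (RGet 3 vi) (sqdist_exp vi vj)])
        Skip (Seq (NSet 6 vi (NConst 1)) (RSet 3 vi (sqdist_exp vi vj))))).

Definition max_cmd :=
  If (BRealLe (RGet 3 vi) (RGet 2 (NConst 0))) Skip (RSet 2 (NConst 0) (RGet 3 vi)).

Definition join_cmd := attach_cmd vi vj.

Definition cover_cmd :=
  If (all_exp [:: near_exp vi vj; eqN (Cof vi) vi; eqN (Dof vi) (NConst 0)])
    join_cmd Skip.

Definition move_cmd := Seq (detach_cmd vi) (attach_cmd vi vj).

Definition split_cmd :=
  If (all_exp [:: near_exp vi vj; eqN (Cof vi) (Cof vj); BNot (eqN (Cof vi) vi);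
        BNot (eqN (Cof vj) vj); BNatLe (NConst 3) (Dof (Cof vi))])
    move_cmd Skip.

Definition flag_cmd :=
  If (all_exp [:: BNatLe (NConst 2) (Dof vi); BNatLe (Dof vi) (NConst 4)])
    raise_flag Skip.

Definition leaf_cmd :=
  If (all_exp [:: eqN flag (NConst 0); near_exp vi vj; BNot (eqN (Cof vi) vi);
        eqN (Dof (Cof vi)) (NConst 5); BNot (eqN vj (Cof vi));
        BNot (all_exp [:: eqN (Cof vj) vj; eqN (Dof vj) (NConst 5)])])
    (Seq move_cmd raise_flag) Skip.

Definition table_cmd :=
  Seq (If (all_exp [:: BNot (eqN vi vj); eqN (Cof vi) (Cof vj)]) (NSet 7 vi vj) Skip)
      (If (all_exp [:: near_exp vi vj; BNot (eqN (Cof vi) (Cof vj));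
             eqN (Dof (Cof vj)) (NConst 1)])
        (NSet 8 vi vj) Skip).

Notation vy := (NGet 7 vi).
Notation vf := (NGet 8 (NGet 7 vi)).

Definition rewire_cmd :=
  Seq (Seq (detach_cmd vi) (detach_cmd vy)) (Seq (attach_cmd vi vj) (attach_cmd vy vf)).

(** Table entries never written are 0, so the guard tests all that is expected of the partner and of
    its outside neighbour. *)
Definition edge_cmd :=
  If (all_exp [:: eqN flag (NConst 0); near_exp vi vj; near_exp vy vf;
        BNot (eqN vy vi); eqN (Cof vy) (Cof vi); eqN (Dof (Cof vi)) (NConst 1);
        BNot (eqN (Cof vj) (Cof vi)); eqN (Dof (Cof vj)) (NConst 1);
        BNot (eqN (Cof vf) (Cof vy)); eqN (Dof (Cof vf)) (NConst 1);
        BNot (all_exp [:: BNot (eqN vj vf); eqN (Cof vj) (Cof vf)])])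
    (Seq rewire_cmd raise_flag) Skip.

(** * Correctness of the loops that build and change the cover *)

Section Phases.
Variables (pts : seq (plane R)) (e : R).
Hypothesis upts : uniq pts.
Local Notation n := (size pts).
Local Notation pt := (nth 0 pts).
Local Notation A := (near pts e).

Definition coords s :=
  rmem s 0 = (fun i => (pt i).1) /\ rmem s 1 = (fun i => (pt i).2).

Definition ctx s := coords s /\ rmem s 2 0 = e.

Lemma ctx_frame c s : ~~ rwrites c -> ctx s -> ctx (den c s).
Proof. by move=> h; rewrite /ctx /coords den_rframe. Qed.

Lemma reval_sqdist s u v : coords s ->
  reval s (sqdist_exp u v) = sqdist (pt (neval s u)) (pt (neval s v)).
Proof. by case=> h0 h1; rewrite /= h0 h1. Qed.

Lemma beval_near s u v : ctx s ->
  beval s (near_exp u v) = A (neval s u) (neval s v).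
Proof.
case=> hc he.
transitivity (~~ beval s (eqN u v) && (reval s (sqdist_exp u v) <= rmem s 2 0)).
  by [].
by rewrite beval_eqN reval_sqdist // he.
Qed.

Let A_sym := near_sym (pts := pts) (e := e).
Let A_irr := near_irr (pts := pts) (e := e).

Definition phase_cost c := (wcost c + 28)%N.

Lemma phase c (J : state R -> Prop) (P : nat -> nat -> state R -> Prop) :
  loop_free c -> ~~ [|| nwrites 0 c, nwrites 3 c | nwrites 4 c] ->
  (forall s k, J s -> J (nupd s 3 0 k) /\ J (nupd s 4 0 k)) ->
  (forall i j s k, P i j s -> P i j (nupd s 3 0 k) /\ P i j (nupd s 4 0 k)) ->
  (forall s i j, (i < n)%N -> (j < n)%N -> nmem s 3 0 = i -> nmem s 4 0 = j ->
     J s ->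
     [/\ J (den c s), P i j (den c s) & forall i' j', (i' < n)%N -> (j' < n)%N ->
          P i' j' s -> P i' j' (den c s)]) ->
  forall s, nmem s 0 0 = n -> J s ->
  reach (Pairs c) n s (phase_cost c * n.+1 ^ 2)
    (fun s' => J s' /\ forall i j, (i < n)%N -> (j < n)%N -> P i j s').
Proof.
move=> h1 h2 h3 h4 h5 s hn hJ.
by have [t [s' [? ? ? ? ?]]] := pairs_exec h1 h2 h3 h4 h5 hn hJ; exists t, s'.
Qed.

Lemma cover_phase s : nmem s 0 0 = n -> ctx s -> nmem s 5 0 = 0%N ->
  nmem s 7 =1 (fun=> 0%N) -> nmem s 8 =1 (fun=> 0%N) ->
  valid n A (nmem s 1) (nmem s 2) ->
  (forall i, (i < n)%N -> exists2 j, (j < n)%N & A i j) ->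
  reach (Pairs cover_cmd) n s (phase_cost cover_cmd * n.+1 ^ 2)
    (fun s' => [/\ ctx s', nmem s' 5 0 = 0%N, nmem s' 7 =1 (fun=> 0%N),
       nmem s' 8 =1 (fun=> 0%N) & covering n A (nmem s' 1) (nmem s' 2)]).
Proof.
move=> hn hc h5 h7 h8 V noiso.
pose J s := [/\ ctx s, nmem s 5 0 = 0%N, nmem s 7 =1 (fun=> 0%N),
       nmem s 8 =1 (fun=> 0%N) & valid n A (nmem s 1) (nmem s 2)].
(* Once [i] is no longer isolated, it stays so by [attach_isolated]. *)
pose P i j s := A i j -> ~ (nmem s 1 i = i /\ nmem s 2 i = 0%N).
have [//|//|//|//||//|t [s' [ex le hn' [[c1 c2 c3 c4 c5] hP]]]] :=
  @phase cover_cmd J P _ _ _ _ _ s hn; last first.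
  exists t, s'; split=> //; split=> //; split=> // i il ci; rewrite lt0n.
  by apply/negP => /eqP di; have [j jl Aij] := noiso i il; apply: (hP i j).
move=> {s hn hc h5 h7 h8 V noiso} s i j il jl hi hj [hc h5 h7 h8 V].
rewrite /cover_cmd den_if.
have -> : beval s (all_exp [:: near_exp vi vj; eqN (Cof vi) vi; eqN (Dof vi) (NConst 0)]) =
    [&& A i j, nmem s 1 i == i & nmem s 2 i == 0%N].
  rewrite !beval_all_cons beval_all_nil andbT !beval_eqN beval_near //.
  by rewrite /= hi hj.
case: ifP => [/and3P[Aij /eqP ci /eqP di]|h]; last first.
  by split=> // Aij' [ci di]; rewrite Aij' ci di eqxx in h.
have [ei ej] : neval s vi = i /\ neval s vj = j by [].
have E : centers (den join_cmd s) = attach (centers s) i j.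
  by rewrite /join_cmd den_attach // ei ej.
have c' : ctx (den join_cmd s) by apply: ctx_frame.
have n5 : nmem (den join_cmd s) 5 = nmem s 5 by rewrite den_frame.
have n7 : nmem (den join_cmd s) 7 = nmem s 7 by rewrite den_frame.
have n8 : nmem (den join_cmd s) 8 = nmem s 8 by rewrite den_frame.
move: (den join_cmd s) E c' n5 n7 n8 => s' E c' n5 n7 n8.
have := attach_isolated A_sym A_irr V il jl Aij ci di.
rewrite -[(nmem s 1, nmem s 2)]/(centers s) -E /= => -[V' ci' S'].
split.
- by split=> //; rewrite ?n5 ?n7 ?n8.
- by move=> _ [c1 _]; rewrite c1 eqxx in ci'.
- by move=> i' j' il' jl' hP Aij' [c1 d1]; apply: hP => //; apply: S'.
Qed.

Lemma den_move s : centers (den move_cmd s) = move (centers s) (nmem s 3 0) (nmem s 4 0).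
Proof.
rewrite /move_cmd den_seq den_attach // den_detach.
by rewrite -![neval _ _]/(nmem _ _ _) !den_frame.
Qed.

Lemma den_rewire s : centers (den rewire_cmd s) =
  let y := nmem s 7 (nmem s 3 0) in
  attach (attach (detach (detach (centers s) (nmem s 3 0)) y)
    (nmem s 3 0) (nmem s 4 0)) y (nmem s 8 y).
Proof.
rewrite /rewire_cmd [den _ s]den_seq 2![den (Seq _ _) _]den_seq.
set s1 := den (detach_cmd vi) s.
set s2 := den (detach_cmd vy) s1.
set s3 := den (attach_cmd vi vj) s2.
have e1 : centers s1 = detach (centers s) (nmem s 3 0) by apply: den_detach.
have y1 : neval s1 vy = nmem s 7 (nmem s 3 0).
  by rewrite -[neval s1 vy]/(nmem s1 7 (nmem s1 3 0)) !den_frame.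
have e2 : centers s2 = detach (centers s1) (neval s1 vy) by apply: den_detach.
have i2 : neval s2 vi = nmem s 3 0.
  by rewrite -[neval s2 vi]/(nmem s2 3 0) !den_frame.
have j2 : neval s2 vj = nmem s 4 0.
  by rewrite -[neval s2 vj]/(nmem s2 4 0) !den_frame.
have e3 : centers s3 = attach (centers s2) (neval s2 vi) (neval s2 vj).
  by apply: den_attach.
have y3 : neval s3 vy = nmem s 7 (nmem s 3 0).
  by rewrite -[neval s3 vy]/(nmem s3 7 (nmem s3 3 0)) !den_frame.
have f3 : neval s3 vf = nmem s 8 (nmem s 7 (nmem s 3 0)).
  by rewrite -[neval s3 vf]/(nmem s3 8 (nmem s3 7 (nmem s3 3 0))) !den_frame.
have stable_f (t : state R) : neval (nupd t 10 0 (neval t vy)) vf = neval t vf by [].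
rewrite (den_attach (stable_f s3)).
by rewrite y3 f3 e3 i2 j2 e2 y1 e1.
Qed.

Definition tables0 s := nmem s 7 =1 (fun=> 0%N) /\ nmem s 8 =1 (fun=> 0%N).

Lemma tables0_frame c s : ~~ (nwrites 7 c || nwrites 8 c) -> tables0 s ->
  tables0 (den c s).
Proof. by case/norP=> h7 h8 [t7 t8]; split; rewrite den_frame. Qed.

Lemma split_phase s : nmem s 0 0 = n -> ctx s -> nmem s 5 0 = 0%N -> tables0 s ->
  covering n A (nmem s 1) (nmem s 2) ->
  reach (Pairs split_cmd) n s (phase_cost split_cmd * n.+1 ^ 2)
    (fun s' => [/\ ctx s', nmem s' 5 0 = 0%N, tables0 s',
       covering n A (nmem s' 1) (nmem s' 2) & small n (nmem s' 2)]).
Proof.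
move=> hn hc h5 ht V.
pose J s := [/\ ctx s, nmem s 5 0 = 0%N, tables0 s & covering n A (nmem s 1) (nmem s 2)].
pose P i j s := A i j -> nmem s 1 i = nmem s 1 j -> nmem s 1 i != i ->
  nmem s 1 j != j -> (nmem s 2 (nmem s 1 i) <= 2)%N.
have [//|//|//|//||//|t [s' [ex le hn' [[c1 c2 c3 c4] hP]]]] :=
  @phase split_cmd J P _ _ _ _ _ s hn; last first.
  exists t, s'; split=> //; split=> //; apply: (split_small upts c4).
  by move=> i j il jl; apply: hP.
move=> {s hn hc h5 ht V} s i j il jl hi hj [hc h5 ht V].
rewrite /split_cmd den_if [den Skip s]/=; set g := all_exp _.
have -> : beval s g = [&& A i j, nmem s 1 i == nmem s 1 j, nmem s 1 i != i,
    nmem s 1 j != j & (2 < nmem s 2 (nmem s 1 i))%N].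
  rewrite /g !beval_all_cons beval_all_nil andbT !beval_not !beval_eqN.
  by rewrite beval_near // /= hi hj.
case: ifP => [/and5P[Aij /eqP cc ci cj di]|h]; last first.
  split=> //; rewrite /P => Aij cc ci cj; rewrite leqNgt; apply/negP => di.
  by rewrite Aij ci cj di cc eqxx in h.
have E := den_move s; rewrite hi hj in E.
have c' : ctx (den move_cmd s) by apply: ctx_frame.
have t' : tables0 (den move_cmd s) by apply: tables0_frame.
have n5 : nmem (den move_cmd s) 5 = nmem s 5 by rewrite den_frame.
move: (den move_cmd s) E c' t' n5 => s' E c' t' n5.
have := split_spec A_sym A_irr V il jl Aij cc ci cj di.
rewrite -[(nmem s 1, nmem s 2)]/(centers s) -E /= => -[V' Ck Dj Dk].
have Dj0 : (0 < nmem s' 2 j)%N by rewrite Dj.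
have Cj := valid_center V'.1 jl Dj0.
(* Either [i'] now belongs to the new star, which has one leaf, or its star has not grown. *)
have stable i' j' : P i' j' s -> P i' j' s'.
  move=> hP Aij'; have [->|ne] := eqVneq (nmem s' 1 i') j.
    by rewrite Dj.
  move=> cc' ci' cj'; have e1 : nmem s' 1 i' = nmem s 1 i'.
    by case: (Ck i') => // h; rewrite h eqxx in ne.
  have e2 : nmem s' 1 j' = nmem s 1 j'.
    by case: (Ck j') => // h; rewrite cc' h eqxx in ne.
  apply: leq_trans (Dk _ ne) _; rewrite e1 in cc' ci' *; rewrite e2 in cc' cj'.
  exact: hP.
split.
- by split=> //; rewrite n5.
- by move=> _ _ _; rewrite Cj eqxx.
- by move=> i' j' _ _; apply: stable.
Qed.

Definition good s := [/\ ctx s, covering n A (nmem s 1) (nmem s 2),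
  small n (nmem s 2), nmem s 5 0 != 0%N -> midstar n (nmem s 2) &
  nmem s 5 0 = 0%N -> ~ midstar n (nmem s 2)].

Lemma flag_phase s : nmem s 0 0 = n -> ctx s -> nmem s 5 0 = 0%N -> tables0 s ->
  covering n A (nmem s 1) (nmem s 2) -> small n (nmem s 2) ->
  reach (Pairs flag_cmd) n s (phase_cost flag_cmd * n.+1 ^ 2)
    (fun s' => good s' /\ tables0 s').
Proof.
move=> hn hc h5 ht V sm.
pose J s := [/\ ctx s, covering n A (nmem s 1) (nmem s 2),
  small n (nmem s 2), nmem s 5 0 != 0%N -> midstar n (nmem s 2) & tables0 s].
pose P (i j : nat) s := nmem s 5 0 = 0%N -> ~ (1 < nmem s 2 i < 5)%N.
have [//|//|//|//|||t [s' [ex le hn' [[c1 c2 c3 c4 c5] hP]]]] :=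
  @phase flag_cmd J P _ _ _ _ _ s hn; last first.
- exists t, s'; split=> //; split=> //; split=> // f0 [k kn dk].
  exact: (hP k k kn kn f0).
- by split=> //; rewrite h5.
move=> {s hn hc h5 ht V sm} s i j il jl hi hj [hc V sm mid ht].
rewrite /flag_cmd den_if [den Skip s]/=; set g := all_exp _.
have -> : beval s g = (1 < nmem s 2 i < 5)%N.
  by rewrite /g !beval_all_cons beval_all_nil andbT /= hi.
case: ifP => [di|h]; last by split=> //; rewrite /P h.
by split=> //; split=> // _; exists i.
Qed.

(** The premise on the flag makes this vacuous after an exchange, which therefore cannot spoil the
    result of earlier visits. *)
Definition no_move_at i j s := nmem s 5 0 = 0%N -> A i j -> nmem s 1 i != i ->
  nmem s 2 (nmem s 1 i) = 5%N -> j != nmem s 1 i ->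
  nmem s 1 j = j /\ nmem s 2 j = 5%N.

Lemma leaf_phase s : nmem s 0 0 = n -> good s -> tables0 s ->
  reach (Pairs leaf_cmd) n s (phase_cost leaf_cmd * n.+1 ^ 2)
    (fun s' => (good s' /\ tables0 s') /\
       forall i j, (i < n)%N -> (j < n)%N -> no_move_at i j s').
Proof.
move=> hn hg ht; apply: (@phase leaf_cmd (fun s => good s /\ tables0 s)) => //.
move=> {s hn hg ht} s i j il jl hi hj [hg ht]; have [hc V sm mid nmid] := hg.
rewrite /leaf_cmd den_if [den Skip s]/=; set g := all_exp _.
have -> : beval s g = [&& nmem s 5 0 == 0%N, A i j, nmem s 1 i != i,
    nmem s 2 (nmem s 1 i) == 5%N, j != nmem s 1 i &
    ~~ ((nmem s 1 j == j) && (nmem s 2 j == 5%N))].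
  rewrite /g !beval_all_cons beval_all_nil andbT !beval_not.
  rewrite !beval_all_cons beval_all_nil andbT !beval_eqN beval_near //.
  by rewrite /= hi hj.
case: ifP => [|h]; last first.
  split=> //; rewrite /no_move_at => f0 Aij ci di jc.
  by move: h; rewrite f0 Aij ci di jc eqxx /= => /negbFE /andP[/eqP -> /eqP ->].
case/and3P=> /eqP f0 Aij /and4P[ci /eqP di jc jj].
have {}jj : ~ (nmem s 1 j = j /\ nmem s 2 j = 5%N).
  by case=> e1 e2; rewrite e1 e2 !eqxx in jj.
have E := den_move s; rewrite hi hj in E.
have c' : ctx (den move_cmd s) by apply: ctx_frame.
have t' : tables0 (den move_cmd s) by apply: tables0_frame.
rewrite den_seq; move: (den move_cmd s) E c' t' => s' E c' t'.
have := move_spec A_sym A_irr V il jl Aij sm (nmid f0) ci di jc jj.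
by rewrite -[(nmem s 1, nmem s 2)]/(centers s) -E /= => -[V' sm' mid'].
Qed.

Definition partner_at i j s := i != j -> nmem s 1 i = nmem s 1 j ->
  nmem s 2 (nmem s 1 i) = 1%N -> nmem s 7 i = j.

(** The entry need not be [j]: later visits may replace it by another suitable neighbour. *)
Definition outer_at i j s := A i j -> nmem s 1 i != nmem s 1 j ->
  nmem s 2 (nmem s 1 j) = 1%N ->
  [/\ A i (nmem s 8 i), nmem s 1 i != nmem s 1 (nmem s 8 i) &
      nmem s 2 (nmem s 1 (nmem s 8 i)) = 1%N].

Definition tables_in s := forall i, (nmem s 7 i < n)%N /\ (nmem s 8 i < n)%N.

Lemma table_phase s : nmem s 0 0 = n -> good s -> tables0 s ->
  (forall i j, (i < n)%N -> (j < n)%N -> no_move_at i j s) -> (0 < n)%N ->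
  reach (Pairs table_cmd) n s (phase_cost table_cmd * n.+1 ^ 2)
    (fun s' => [/\ good s', tables_in s',
       forall i j, (i < n)%N -> (j < n)%N -> no_move_at i j s' &
       forall i j, (i < n)%N -> (j < n)%N -> partner_at i j s' /\ outer_at i j s']).
Proof.
move=> hn hg ht hm n0.
pose J s := [/\ good s, tables_in s &
       forall i j, (i < n)%N -> (j < n)%N -> no_move_at i j s].
have [//|//|//|//|||t [s' [ex le hn' [[c1 c2 c3] hP]]]] :=
  @phase table_cmd J (fun i j s => partner_at i j s /\ outer_at i j s) _ _ _ _ _ s hn; last first.
- by exists t, s'; split.
- by split=> // i; case: ht => -> ->.
move=> {s hn hg ht hm} s i j il jl hi hj [hg ht hm]; have [hc V sm mid nmid] := hg.
have c' : ctx (den table_cmd s) by apply: ctx_frame.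
have n1 : nmem (den table_cmd s) 1 = nmem s 1 by rewrite den_frame.
have n2 : nmem (den table_cmd s) 2 = nmem s 2 by rewrite den_frame.
have n5 : nmem (den table_cmd s) 5 = nmem s 5 by rewrite den_frame.
have n7 k : nmem (den table_cmd s) 7 k =
    if [&& k == i, i != j & nmem s 1 i == nmem s 1 j] then j else nmem s 7 k.
  rewrite /table_cmd den_seq den_frame; last by [].
  rewrite den_if !beval_all_cons beval_all_nil andbT !beval_not !beval_eqN /= hi hj.
  by case: ifP => h; rewrite /= /upd /= ?hi ?hj; case: (k == i).
have n8 k : nmem (den table_cmd s) 8 k =
    if [&& k == i, A i j, nmem s 1 i != nmem s 1 j & nmem s 2 (nmem s 1 j) == 1%N]
    then j else nmem s 8 k.
  rewrite /table_cmd den_seq; set s1 := den (If _ _ _) s.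
  have s1c : ctx s1 by apply: ctx_frame.
  have s11 : nmem s1 1 = nmem s 1 by rewrite den_frame.
  have s12 : nmem s1 2 = nmem s 2 by rewrite den_frame.
  have s13 : nmem s1 3 0 = i by rewrite den_frame.
  have s14 : nmem s1 4 0 = j by rewrite den_frame.
  have s18 : nmem s1 8 = nmem s 8 by rewrite den_frame.
  rewrite den_if !beval_all_cons beval_all_nil andbT !beval_not !beval_eqN.
  rewrite beval_near // /= s11 s12 s13 s14.
  by case: ifP => h; rewrite /= /upd /= ?s13 ?s14 s18; case: (k == i).
split.
- split.
  + by rewrite /good n1 n2 n5.
  + move=> k; rewrite n7 n8; have [h7 h8] := ht k.
    by split; case: ifP.
  + by move=> i' j' il' jl'; rewrite /no_move_at n1 n2 n5; apply: hm.
- rewrite /partner_at /outer_at n1 n2 n7 n8 eqxx /=; split.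
    by move=> -> -> _; rewrite eqxx.
  by move=> a h d1; rewrite a h d1 eqxx.
- move=> i' j' il' jl' [hp ho]; rewrite /partner_at /outer_at n1 n2 n7 n8; split.
    move=> ij cc d1; case: ifP => [/and3P[/eqP e1 ij2 /eqP cc2]|_]; last exact: hp.
    rewrite e1 in cc d1 ij.
    (* Overwriting the entry is harmless: the other end of an edge is unique. *)
    by apply: (edge_three V.1 il jl jl') => //; rewrite // eq_sym.
  move=> a1 a2 a3; case: ifP => [/and4P[/eqP -> b1 b2 /eqP b3]|_] //.
  exact: ho.
Qed.

Definition no_rewire_at x b s := let y := nmem s 7 x in let f := nmem s 8 y in
  nmem s 5 0 = 0%N -> A x b -> A y f -> y != x -> nmem s 1 y = nmem s 1 x ->
  nmem s 2 (nmem s 1 x) = 1%N -> nmem s 1 b != nmem s 1 x ->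
  nmem s 2 (nmem s 1 b) = 1%N -> nmem s 1 f != nmem s 1 y ->
  nmem s 2 (nmem s 1 f) = 1%N -> b != f /\ nmem s 1 b = nmem s 1 f.

Lemma edge_phase s : nmem s 0 0 = n -> good s -> tables_in s ->
  (forall i j, (i < n)%N -> (j < n)%N -> no_move_at i j s) ->
  (forall i j, (i < n)%N -> (j < n)%N -> partner_at i j s /\ outer_at i j s) ->
  reach (Pairs edge_cmd) n s (phase_cost edge_cmd * n.+1 ^ 2)
    (fun s' => [/\ good s', tables_in s' & nmem s' 5 0 = 0%N ->
       forall i j, (i < n)%N -> (j < n)%N ->
       [/\ no_move_at i j s', partner_at i j s', outer_at i j s' & no_rewire_at i j s']]).
Proof.
move=> hn hg ht hm hp.
pose J s := [/\ good s, tables_in s & nmem s 5 0 = 0%N ->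
   forall i j, (i < n)%N -> (j < n)%N ->
       [/\ no_move_at i j s, partner_at i j s & outer_at i j s]].
have [//|//|//|//|||t [s' [ex le hn' [[c1 c2 c3] hP]]]] :=
  @phase edge_cmd J no_rewire_at _ _ _ _ _ s hn; last first.
- exists t, s'; split=> //; split=> // f0 i j il jl.
  by have [? ? ?] := c3 f0 i j il jl; split=> //; apply: hP.
- split=> // _ i j il jl; have [? ?] := hp i j il jl; split=> //; exact: hm.
move=> {s hn hg ht hm hp} s i j il jl hi hj [hg ht hm].
have [hc V sm mid nmid] := hg.
rewrite /edge_cmd den_if [den Skip s]/=; set g := all_exp _.
pose y := nmem s 7 i; pose f := nmem s 8 y.
have -> : beval s g = [&& nmem s 5 0 == 0%N, A i j, A y f, y != i &
   [&& nmem s 1 y == nmem s 1 i, nmem s 2 (nmem s 1 i) == 1%N,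
       nmem s 1 j != nmem s 1 i, nmem s 2 (nmem s 1 j) == 1%N &
   [&& nmem s 1 f != nmem s 1 y, nmem s 2 (nmem s 1 f) == 1%N &
       ~~ ((j != f) && (nmem s 1 j == nmem s 1 f))]]].
  rewrite /g !beval_all_cons beval_all_nil andbT !beval_not.
  rewrite !beval_all_cons beval_all_nil andbT !beval_not !beval_eqN !beval_near //.
  by rewrite /= hi hj -/y -/f.
case: ifP => [|h]; last first.
  split=> //; rewrite /no_rewire_at -/y -/f => f0 a1 a2 a3 a4 a5 a6 a7 a8 a9.
  move: h; rewrite f0 a1 a2 a3 a4 a5 -a4 a7 a8 a9 a4 a6 !eqxx /=.
  by move=> /negbFE /andP[-> /eqP ->].
case/and5P=> /eqP f0 a1 a2 a3 /and5P[/eqP a4 /eqP a5 a6 /eqP a7].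
case/and3P=> a8 /eqP a9 a10.
have yn : (y < n)%N := (ht i).1.
have fn : (f < n)%N := (ht y).2.
have be : (j == f) || (nmem s 1 j != nmem s 1 f).
  by move: a10; rewrite negb_and negbK.
have E : centers (den rewire_cmd s) =
    attach (attach (detach (detach (centers s) i) y) i j) y f.
  by rewrite den_rewire hi hj.
have c' : ctx (den rewire_cmd s) by apply: ctx_frame.
have n7 : nmem (den rewire_cmd s) 7 = nmem s 7 by rewrite den_frame.
have n8 : nmem (den rewire_cmd s) 8 = nmem s 8 by rewrite den_frame.
rewrite den_seq; move: (den rewire_cmd s) E c' n7 n8 => s' E c' n7 n8.
have := rewire_spec A_sym A_irr V il yn jl fn a1 a2 sm a3 a4 a5 a6 a7 a8 a9 be.
rewrite -[(nmem s 1, nmem s 2)]/(centers s) -E /= => -[V' sm' mid'].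
by split=> //; split=> // k; have := ht k; rewrite -n7 -n8.
Qed.

End Phases.

(** * Computation of the squared threshold *)

Section Threshold.
Variable pts : seq (plane R).
Local Notation n := (size pts).
Local Notation pt := (nth 0 pts).

Definition blank s := [/\ coords pts s, nmem s 2 =1 (fun=> 0%N), nmem s 5 0 = 0%N &
  tables0 s].

Definition nearest (m : nat -> R) i :=
  (exists2 j, (j < n)%N & j != i /\ m i = sqdist (pt i) (pt j)) /\
  (forall j, (j < n)%N -> i != j -> m i <= sqdist (pt i) (pt j)).

Lemma den_min s : coords pts s -> let i := nmem s 3 0 in let j := nmem s 4 0 in
  let d := sqdist (pt i) (pt j) in
  den min_cmd s = if i == j then nupd s 1 i i
    else if (0 < nmem s 6 i)%N && (rmem s 3 i <= d) then nupd s 1 i i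
    else rupd (nupd (nupd s 1 i i) 6 i 1) 3 i d.
Proof.
move=> hc i j d; rewrite /min_cmd den_seq.
rewrite -[den (NSet 1 vi vi) s]/(nupd s 1 i i).
have c1 : coords pts (nupd s 1 i i) by [].
rewrite den_if beval_eqN -[neval _ vi]/i -[neval _ vj]/j.
case: ifP => // _; rewrite den_if; set g := all_exp _.
have -> : beval (nupd s 1 i i) g = (0 < nmem s 6 i)%N && (rmem s 3 i <= d).
  rewrite /g !beval_all_cons beval_all_nil andbT.
  rewrite -[beval _ (BRealLe _ _)]/(rmem s 3 i <= reval (nupd s 1 i i) (sqdist_exp vi vj)).
  by rewrite (reval_sqdist _ _ c1).
case: ifP => // _; rewrite den_seq.
rewrite -[den (NSet 6 _ _) _]/(nupd (nupd s 1 i i) 6 i 1).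
have c2 : coords pts (nupd (nupd s 1 i i) 6 i 1) by [].
rewrite -[den _ _]/(rupd (nupd (nupd s 1 i i) 6 i 1) 3 i
  (reval (nupd (nupd s 1 i i) 6 i 1) (sqdist_exp vi vj))).
by rewrite (reval_sqdist _ _ c2).
Qed.

Lemma min_phase s : (1 < n)%N -> nmem s 0 0 = n -> blank s -> rmem s 2 0 = 0 ->
  nmem s 6 =1 (fun=> 0%N) ->
  reach (Pairs min_cmd) n s (phase_cost min_cmd * n.+1 ^ 2)
    (fun s' => [/\ blank s', rmem s' 2 0 = 0 & forall i, (i < n)%N ->
       nmem s' 1 i = i /\ nearest (rmem s' 3) i]).
Proof.
move=> n1 hn hb he h6.
pose J s := [/\ blank s, rmem s 2 0 = 0 & forall i, (i < n)%N -> (0 < nmem s 6 i)%N ->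
  exists2 j, (j < n)%N & j != i /\ rmem s 3 i = sqdist (pt i) (pt j)].
pose P i j s := nmem s 1 i = i /\
  (i != j -> (0 < nmem s 6 i)%N /\ rmem s 3 i <= sqdist (pt i) (pt j)).
have [//|//|//|//|||t [s' [ex le hn' [[c1 c2 c3] hP]]]] :=
  @phase pts min_cmd J P _ _ _ _ _ s hn; last first.
- exists t, s'; split=> //; split=> // i il; split; first by have [] := hP i i il il.
  split=> [|j jl ij]; last by have [_ /(_ ij)[]] := hP i j il jl.
  have [j jl ij] : exists2 j, (j < n)%N & i != j.
    by case: (posnP i) => [->|i0]; [exists 1%N | exists 0%N; rewrite -?lt0n //; lia].
  by have [_ /(_ ij)[h _]] := hP i j il jl; apply: c3.
- by split=> // i il; rewrite h6.
move=> {s hn hb he h6} s i j il jl hi hj [[hc h2 h5 ht] he hm].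
have := den_min hc; rewrite hi hj => ->.
have [ij|ij] := eqVneq i j.
  subst j; split.
  - by split.
  - by split=> [|/eqP//]; rewrite /= /upd /= eqxx.
  - move=> i' j' il' jl' [p1 p2]; split; last exact: p2.
    by rewrite /= /upd /=; case: eqP.
case: ifP => [/andP[m0 md]|better].
  split.
  - by split.
  - by split; [rewrite /= /upd /= eqxx | ].
  - move=> i' j' il' jl' [p1 p2]; split; last exact: p2.
    by rewrite /= /upd /=; case: eqP.
split.
- split=> // i' il'; rewrite /= /upd /=; case: (eqVneq i' i) => [->|ne].
    by exists j; rewrite // eq_sym.
  exact: hm.
- by split; rewrite /= /upd /= !eqxx.
- move=> i' j' il' jl' [p1 p2]; split.
    by rewrite /= /upd /=; case: eqP.
  move=> ij'; have [q1 q2] := p2 ij'; rewrite /= /upd /=.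
  case: (eqVneq i' i) => [e1|//]; subst i'; split=> //.
  apply: le_trans q2; move: better; rewrite q1 /= => /negbT.
  by rewrite -ltNge => /ltW.
Qed.

Definition centered s := forall i, (i < n)%N -> nmem s 1 i = i.

Lemma max_phase s : (0 < n)%N -> nmem s 0 0 = n -> blank s -> rmem s 2 0 = 0 ->
  (forall i, (i < n)%N -> nmem s 1 i = i /\ nearest (rmem s 3) i) ->
  reach (Pairs max_cmd) n s (phase_cost max_cmd * n.+1 ^ 2)
    (fun s' => [/\ blank s', centered s', 0 <= rmem s' 2 0,
       exists2 i, (i < n)%N & forall j, (j < n)%N -> j != i ->
         rmem s' 2 0 <= sqdist (pt i) (pt j) &
       forall i, (i < n)%N -> exists2 j, (j < n)%N & near pts (rmem s' 2 0) i j]).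
Proof.
move=> n0 hn hb he hm.
pose J s := [/\ blank s, centered s, 0 <= rmem s 2 0,
  forall i, (i < n)%N -> nearest (rmem s 3) i &
  rmem s 2 0 = 0 \/ exists2 i, (i < n)%N & rmem s 2 0 = rmem s 3 i].
pose P (i j : nat) s := rmem s 3 i <= rmem s 2 0.
have [//|//|//|//|||t [s' [ex le hn' [[c1 c2 c3 c4 c5] hP]]]] :=
  @phase pts max_cmd J P _ _ _ _ _ s hn; last first.
- exists t, s'; split=> //; split=> //.
    (* If the cell still holds its initial 0, any point will do. *)
    case: c5 => [->|[i il ->]].
      by exists 0%N => // j _ _; apply: sqdist_ge0.
    exists i => // j jl ji; have [_ h] := c4 i il.
    by apply: h => //; rewrite eq_sym.
  move=> i il; have [[j jl [ji e]] _] := c4 i il.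
  by exists j => //; rewrite /near eq_sym ji -e; apply: (hP i i).
- split=> //; [by move=> i /hm[] | by rewrite he | by move=> i /hm[] | by left].
move=> {s hn hb he hm} s i j il jl hi hj [hb hc he hm h].
have -> : den max_cmd s =
    if rmem s 3 i <= rmem s 2 0 then s else rupd s 2 0 (rmem s 3 i).
  by rewrite -hi.
case: leP => hl; first by split.
split.
- split=> //; first by apply: le_trans he _; rewrite /= /upd /= ltW.
  by right; exists i.
- by rewrite /P /= /upd /=.
- by move=> i' j' _ _; rewrite /P /= /upd /= => h'; apply: le_trans h' (ltW hl).
Qed.

End Threshold.

(** * Composition of the phases *)

Definition star_cover_program :=
  Seq (Pairs min_cmd) (Seq (Pairs max_cmd) (Seq (Pairs cover_cmd)
  (Seq (Pairs split_cmd) (Seq (Pairs flag_cmd) (Seq (Pairs leaf_cmd)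
  (Seq (Pairs table_cmd) (Pairs edge_cmd))))))).

Definition program_cost :=
  (phase_cost min_cmd + (phase_cost max_cmd + (phase_cost cover_cmd +
  (phase_cost split_cmd + (phase_cost flag_cmd + (phase_cost leaf_cmd +
  (phase_cost table_cmd + phase_cost edge_cmd)))))))%N.

Lemma centered_valid pts A s : blank pts s -> centered pts s ->
  valid (size pts) A (nmem s 1) (nmem s 2).
Proof.
move=> [_ h2 _ _] hc i il; rewrite hc // hc // eqxx; split=> //.
rewrite h2 /deg; apply/esym/eqP; rewrite -leqn0 leqNgt -has_count.
apply/hasP => -[j]; rewrite mem_iota add0n /= => jl /andP[ji].
by rewrite hc // (negbTE ji).
Qed.

Lemma program_correct pts s : uniq pts -> (1 < size pts)%N ->
  nmem s 0 0 = size pts -> blank pts s -> rmem s 2 0 = 0 ->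
  nmem s 6 =1 (fun=> 0%N) ->
  reach star_cover_program (size pts) s (program_cost * (size pts).+1 ^ 2)
    (fun s' => exists e, [/\ 0 <= e,
       exists2 i, (i < size pts)%N & forall j, (j < size pts)%N -> j != i ->
         e <= sqdist (nth 0 pts i) (nth 0 pts j),
       good pts e s', tables_in pts s' & nmem s' 5 0 = 0%N ->
       forall i j, (i < size pts)%N -> (j < size pts)%N ->
       [/\ no_move_at pts e i j s', partner_at i j s', outer_at pts e i j s' &
           no_rewire_at pts e i j s']]).
Proof.
move=> up n1 hn hb h2 h6; have n0 := ltnW n1.
set q := ((size pts).+1 ^ 2)%N.
have -> : (program_cost * q = phase_cost min_cmd * q + (phase_cost max_cmd * q +
    (phase_cost cover_cmd * q + (phase_cost split_cmd * q + (phase_cost flag_cmd * q +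
    (phase_cost leaf_cmd * q + (phase_cost table_cmd * q + phase_cost edge_cmd * q)))))))%N.
  by rewrite /program_cost !mulnDl.
apply: reach_seq; first exact: (min_phase n1 hn hb h2 h6).
move=> {s hn hb h2 h6} s hn [hb h2 hm].
apply: reach_seq; first exact: (max_phase n0 hn hb h2 hm).
move=> {s hn hb h2 hm} s hn [hb hc e0 tight noiso].
(* A name for the threshold that does not mention the changing state. *)
have [e he] : exists e, rmem s 2 0 = e by eexists.
rewrite he in e0 tight noiso; have V := centered_valid (near pts e) hb hc.
have [hco _ h5 [h7 h8]] := hb.
apply: reach_seq; first exact: (cover_phase hn (conj hco he) h5 h7 h8 V noiso).
move=> {s hn hb hc he V hco h5 h7 h8} s hn [hc h5 h7 h8 cov].
apply: reach_seq; first exact: (split_phase up hn hc h5 (conj h7 h8) cov).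
move=> {s hn hc h5 h7 h8 cov} s hn [hc h5 ht cov sm].
apply: reach_seq; first exact: (flag_phase hn hc h5 ht cov sm).
move=> {s hn hc h5 ht cov sm} s hn [hg ht].
apply: reach_seq; first exact: (leaf_phase hn hg ht).
move=> {s hn hg ht} s hn [[hg ht] hm].
apply: reach_seq; first exact: (table_phase hn hg ht hm n0).
move=> {s hn hg ht hm} s hn [hg ht hm hp].
have [t [s' [ex le hn' [g' t' fin]]]] := edge_phase hn hg ht hm hp.
by exists t, s'; split=> //; exists e.
Qed.

End Program.

Theorem theorem23 (R : realType) :
  exists (prog : cmd) (C : nat),
  forall (n : nat) (S : {fset plane R}) (pts : seq (plane R)),
    (0 < n)%N -> ~~ odd n -> #|` S|%fset = n ->
    uniq pts -> pts =i S ->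
    exists (t : nat) (s' : state R),
      [/\ exec prog (input_state pts) t s',
          (t <= C * n ^ 2)%N,
          star_cover S (output_cover pts s') &
          (Delta (output_cover pts s') = 4%N /\
           forall alpha : {fset star R},
             star_cover S alpha ->
             (Delta (output_cover pts s') <= Delta alpha)%N)
          \/ (Delta (output_cover pts s') <= 2)%N].
Proof.
(* The loops cost a multiple of [n.+1 ^ 2], and [n.+1] is at most [2 * n]: hence the factor 4. *)
exists star_cover_program, (program_cost * 4)%N => n S pts n0 ev cS up pS.
have {cS} cn : n = size pts by rewrite -cS (card_pts up pS).
(* Being positive and even, the size is at least 2, so nearest neighbours exist. *)
subst n; have n1 : (1 < size pts)%N by move: n0 ev; case: (size pts) => [|[]].
have hb : blank pts (input_state pts) by split=> //; split.
have [t [s' [ex le hn [e [e0 tight hg ht fin]]]]] :=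
  program_correct up n1 (s := input_state pts) erefl hb erefl (fun=> erefl).
have [_ cov sm mid nmid] := hg.
exists t, s'; split=> //.
- apply: leq_trans le _; rewrite -mulnA leq_mul2l; apply/orP; right.
  by rewrite -[4%N]/(2 ^ 2)%N -expnMn leq_sqr mul2n -addnn -addn1 leq_add2l.
- exact: (stars_of_cover up pS e0 tight cov n1).
have [f0|f1] := eqVneq (nmem s' 5 0) 0%N; last first.
  by right; apply: (stars_of_mid up pS e0 tight cov n1 ev sm (mid f1)).
apply: rigid_optimal; apply: (stars_of_rigid up pS e0 tight cov n1 sm (nmid f0)).
  by move=> i j il jl; have [h _ _ _] := fin f0 i j il jl; apply: h.
apply: (rewire_search cov.1 ht).
- by move=> i j il jl; have [_ h _ _] := fin f0 i j il jl.
- by move=> i j il jl; have [_ _ h _] := fin f0 i j il jl.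
- by move=> x b xl bl; have [_ _ _ h] := fin f0 x b xl bl; apply: h.
Qed.
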